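(* Let $F$ be an arbitrary field and let $A\subseteq F$ with $|A|=7$. Then $A$ is an MSTD set if and only if one of the following holds: (1) $\operatorname{char}(F)=7$ and $A$ is affinely equivalent in $F$ to $\{0,\ a,\ a+2b,\ a+3b,\ b,\ 2b,\ 4b\}$ for some $a,b\in F$ that are linearly independent over $\mathbb{Z}/7\mathbb{Z}$; (2) $\operatorname{char}(F)=17$ and $A$ is affinely equivalent in $F$ to $\{0,1,2,3,5,6,14\}$; (3) $\operatorname{char}(F)=19$ and $A$ is affinely equivalent in $F$ to $\{0,1,2,3,8,10,13\}$.
   Context: For a finite subset $A$ of a field $F$, $A+A=\{a_1+a_2: a_1,a_2\in A\}$ and $A-A=\{a_1-a_2: a_1,a_2\in A\}$; $A$ is a More Sums Than Differences (MSTD) set if $|A+A|>|A-A|$. A set $C\subseteq F$ is affinely equivalent to (an affine transformation of) $A\subseteq F$ if there exist $x,y\in F$ with $x\neq 0$ such that $C=x\cdot A+y=\{xa+y: a\in A\}$. Integers appearing as elements or coefficients denote their images in $F$ under the canonical map $\mathbb{Z}\to F$. In characteristic $p$, $F$ is regarded as a vector space over its prime field $\mathbb{Z}/p\mathbb{Z}$. *)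

(* Defs.v *)
From HB Require Import structures.
From mathcomp Require Import all_boot all_order all_algebra all_field.
From mathcomp Require Import finmap.

Set Implicit Arguments.
Unset Strict Implicit.
Unset Printing Implicit Defensive.

Import GRing.Theory.

Local Open Scope fset_scope.
Local Open Scope ring_scope.

Definition sumset (F : fieldType) (A : {fset F}) : {fset F} :=
  [fset a1 + a2 | a1 in A, a2 in A].

Definition diffset (F : fieldType) (A : {fset F}) : {fset F} :=
  [fset a1 - a2 | a1 in A, a2 in A].

Definition MSTD (F : fieldType) (A : {fset F}) : Prop :=
  (#|` diffset A| < #|` sumset A|)%N.

Definition affine_image (F : fieldType) (x y : F) (A : {fset F}) : {fset F} :=
  [fset x * a + y | a in A].

Definition affinely_equivalent (F : fieldType) (C A : {fset F}) : Prop :=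
  exists x y : F, x != 0 /\ C = affine_image x y A.

(* [free] from [vector] requires a finite-dimensional space, whereas a field
   may have infinite dimension over its prime field. *)
Definition lin_indep2 (K : fieldType) (V : lmodType K) (u v : V) : Prop :=
  forall c d : K, c *: u + d *: v = 0 -> c = 0 /\ d = 0.

(* [pPrimeCharType charFp] is [F] with its 'F_p-module structure. *)
Definition prime_lin_indep2 (F : fieldType) (p : nat)
    (charFp : p \in [pchar F]) (a b : F) : Prop :=
  @lin_indep2 'F_p (pPrimeCharType charFp) a b.

(* Main.v *)
Require Import Defs.
From HB Require Import structures.
From Stdlib Require Import ZArith.
From mathcomp Require Import all_boot all_order all_algebra all_field.
From mathcomp Require Import finmap ssrZ zify ring.

Set Implicit Arguments.
Unset Strict Implicit.
Unset Printing Implicit Defensive.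

Import GRing.Theory.

Local Open Scope fset_scope.
Local Open Scope ring_scope.

(** Let [|A| = 7].  If [2 = 0] in [F], then [A + A = A - A]; assume [2 != 0].

    If every nonzero difference has at most two representations and no sum [s]
    comes from three disjoint pairs [{x, s - x}], the additive energy, computed
    from differences and from sums, gives [|A - A| <= 21], while the 42 ordered
    pairs of distinct elements give [|A - A| >= 22].  So an MSTD set contains a
    4-term progression, or a 3-term progression and a disjoint pair with the
    same difference, or three disjoint pairs with the same difference, or (in
    characteristic 3) an affine line, or three pairs symmetric about a point.
    In each case the elements of [A] are, up to translation, seven integral
    linear forms in four or five unknown parameters.

    From there a finite search decides everything.  If the seven forms have at
    most [S] distinct pairwise sums, then [|A - A| < |A + A| <= S], so two among
    any [S/2] differences that are distinct up to sign as forms must agree up to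
    sign in [F].  Such a coincidence is a linear equation in the parameters: it
    either eliminates a parameter or forces the characteristic to divide its
    content.  Equations already treated are excluded from the later branches. *)

(** * The search *)

(* A linear form is the list of its coefficients; below, [m] is the
   characteristic, or [0] while it is unknown. *)
Notation lform := (seq Z).

Section Computation.

Local Open Scope Z_scope.

(** * Arithmetic of linear forms and enumeration of pairs *)

Fixpoint zipf (op : Z -> Z -> Z) (u v : lform) : lform :=
  match u, v with
  | [::], _ => map (op 0) v
  | _, [::] => map (op^~ 0) u
  | a :: u', b :: v' => op a b :: zipf op u' v'
  end.

Fixpoint veq (u v : lform) : bool :=
  match u, v with
  | [::], [::] => true
  | a :: u', b :: v' => if Z.eqb a b then veq u' v' else false
  | _, _ => false
  end.

Definition reduce (m : Z) (v : lform) : lform :=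
  if m =? 0 then v else map (Z.modulo^~ m) v.
Definition vsub m u v := reduce m (zipf Z.sub u v).
Definition vadd m u v := reduce m (zipf Z.add u v).

Definition vmem (v : lform) (s : seq lform) : bool := has (veq v) s.

Fixpoint dedup (seen s : seq lform) : seq lform :=
  if s is v :: s' then
    if vmem v seen then dedup seen s' else v :: dedup (v :: seen) s'
  else [::].

(** Started with [seen] empty, it visits each unordered pair of positions once, later element first,
    so that [all] of the result turns into [pairwise]. *)
Fixpoint prior_pairs (T U : Type) (f : T -> T -> seq U) (seen s : seq T) :=
  if s is x :: s' then
    flatten (map (f x) seen) ++ prior_pairs f (rcons seen x) s'
  else [::].

Fixpoint lead (v : lform) : Z :=
  if v is a :: v' then if a =? 0 then lead v' else a else 0.

(* In characteristic [m], the residues above [m / 2] count as negative. *)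
Definition negative (m a : Z) : bool :=
  if m =? 0 then a <? 0 else m <? 2 * a.

Definition up_to_sign (m : Z) (v : lform) : lform :=
  if negative m (lead v) then reduce m (map Z.opp v) else v.

Definition diffs m (pts : seq lform) : seq lform :=
  dedup [::] (prior_pairs (fun p q => [:: up_to_sign m (vsub m p q)]) [::] pts).

Definition sums m (pts : seq lform) : seq lform :=
  dedup [::] (map (fun p => vadd m p p) pts ++
              prior_pairs (fun p q => [:: vadd m p q]) [::] pts).

(** The equations [d - e = 0] and [d + e = 0] are the two ways in which [d] and [e] can agree up to
    sign. *)
Definition collisions m (ds : seq lform) : seq lform :=
  prior_pairs (fun d e => [:: vsub m d e; vadd m d e]) [::] ds.

(* When the fuel runs out the remaining cofactor stands for its own factors. *)
Fixpoint factor_from (fuel : nat) (p n : Z) : seq Z :=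
  if fuel is fuel'.+1 then
    if n =? 1 then [::]
    else if n mod p =? 0 then
      let r := factor_from fuel' p (n / p) in
      if head 0 r =? p then r else p :: r
    else factor_from fuel' (p + 1) n
  else [:: n].

(** The factor 2 does not vanish in [F], since characteristic 2 is settled separately. *)
Definition odd_factors (n : Z) : seq Z :=
  filter (fun q => negb (q =? 2)) (factor_from 64 2 (Z.abs n)).

Fixpoint inverse_from (fuel : nat) (m c k : Z) : Z :=
  if fuel is fuel'.+1 then
    if (c * k) mod m =? 1 then k else inverse_from fuel' m c (k + 1)
  else 0.

Definition content (v : lform) : Z := foldr Z.gcd 0 v.

(** Makes proportional forms comparable: [v = g v'] with [v'] primitive and of positive leading
    coefficient when [m = 0], and, modulo a nonzero [m], with leading coefficient 1. If no inverse
    is found modulo [m], the form is kept as it is; [None] is the zero form. *)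
Definition normalize (m : Z) (v : lform) : option (Z * lform) :=
  let a := lead v in
  if a =? 0 then None
  else if m =? 0 then
    let g := if a <? 0 then - content v else content v in
    if g =? 1 then Some (1, v) else Some (g, map (Z.div^~ g) v)
  else
    let k := inverse_from 64 m a 1 in
    if (k * a) mod m =? 1 then
      Some (a, map (fun b => (k * b) mod m) v)
    else Some (1, v).

(* Only a hash: membership compares the stored forms, so injectivity of [key]
   is irrelevant. *)
Fixpoint key_pos (p acc : positive) : positive :=
  match p with
  | xH => xO acc
  | xO p' => key_pos p' (xI (xO acc))
  | xI p' => key_pos p' (xI (xI acc))
  end.
Definition key_Z (a : Z) (acc : positive) : positive :=
  match a with
  | Z0 => xO acc
  | Zpos p => xI (xO (key_pos p acc))
  | Zneg p => xI (xI (key_pos p acc))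
  end.
Definition key (v : lform) : positive := foldr key_Z xH v.

(** * Hashed sets of forms *)

Inductive trie := Leaf | Node of trie & seq lform & trie.

Fixpoint trie_get (t : trie) (p : positive) : seq lform :=
  if t is Node l b r then
    match p with
    | xH => b | xO p' => trie_get l p' | xI p' => trie_get r p'
    end
  else [::].

Fixpoint trie_add (v : lform) (t : trie) (p : positive) : trie :=
  let: (l, b, r) := if t is Node l b r then (l, b, r) else (Leaf, [::], Leaf) in
  match p with
  | xH => Node l (v :: b) r
  | xO p' => Node (trie_add v l p') b r
  | xI p' => Node l b (trie_add v r p')
  end.

Record forms := Forms { form_seq : seq lform; form_trie : trie }.
Definition no_forms := Forms [::] Leaf.
Definition known (v : lform) (s : forms) : bool :=
  vmem v (trie_get (form_trie s) (key v)).
Definition insert (v : lform) (s : forms) : forms :=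
  if known v s then s
  else Forms (v :: form_seq s) (trie_add v (form_trie s) (key v)).

Fixpoint normalize_all m (vs : seq lform) (s : forms) : option forms :=
  if vs is v :: vs' then
    if normalize m v is Some (_, v') then
      normalize_all m vs' (insert v' s)
    else None
  else Some s.

(** A coefficient 1 or -1 is preferred because eliminating its parameter divides by nothing and so
    opens no case on the characteristic. *)
Definition pivot (v : lform) : nat :=
  let i := find (fun a => Z.abs a =? 1) v in
  if leq i.+1 (size v) then i else find (fun a => negb (a =? 0)) v.

Fixpoint remove (T : Type) (i : nat) (v : seq T) : seq T :=
  match i, v with
  | _, [::] => [::]
  | O, _ :: v' => v'
  | i'.+1, a :: v' => a :: remove i' v'
  end.

(* On the hyperplane [f = 0] this is [c * v] written without the [i]-th
   parameter, where [c] is the [i]-th coefficient of [f]. *)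
Definition eliminate m (i : nat) (c : Z) (f v : lform) : lform :=
  let b := nth 0 v i in
  reduce m
    (if b =? 0 then
       if c =? 1 then remove i v else map (Z.mul c) (remove i v)
     else zipf (fun x y => c * x - b * y) (remove i v) (remove i f)).

(** Only an unknown characteristic opens cases: once [m] is fixed, no further factor has to be
    tried. *)
Definition new_primes (m : Z) (ps : seq Z) (n : Z) : seq Z :=
  if m =? 0 then
    filter (fun q => negb (has (Z.eqb q) ps)) (odd_factors n)
  else [::].

(** * Branching on a forced coincidence *)

Definition state_check := Z -> seq lform -> forms -> seq Z -> bool.

(* [if] is lazy where [&&] and [||] would evaluate the pruned branches. *)
Section Branch.

Variable go : state_check.

(** [None] means that a form already dealt with vanishes identically on the hyperplane [f = 0],
    which closes the branch. For nonzero [m] the pivot coefficient must be 1, hence is nonzero in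
    [F]. *)
Definition substitute m pts s ps (f : lform) : bool :=
  let i := pivot f in
  let c := nth 0 f i in
  if (if m =? 0 then true else c =? 1) then
    if normalize_all m (map (eliminate m i c f) (form_seq s)) no_forms is Some s'
    then go m (map (eliminate m i c f) pts) s' ps
    else true
  else false.

(** The modulus 0 is refused because it stands for an unknown characteristic. [extra] is an equation
    still to be imposed modulo [q], where it may have become trivial or already dealt with. *)
Definition enter_char pts s (extra : option lform) (q : Z) : bool :=
  let pts' := map (reduce q) pts in
  if q =? 0 then false else
  if normalize_all q (map (reduce q) (form_seq s)) no_forms is Some s' then
    if obind (fun f => normalize q (reduce q f)) extra is Some (_, f') then
      if known f' s' then true else substitute q pts' s' [::] f'
    else go q pts' s' [::]
  else true.

(** Eliminating the pivot parameter of [f] needs an invertible coefficient, so each new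
    characteristic dividing that coefficient is first tried together with [f = 0]. *)
Definition impose m pts s ps (f : lform) : bool :=
  let qs := new_primes m ps (nth 0 f (pivot f)) in
  if all (enter_char pts s (Some f)) qs then substitute m pts s (qs ++ ps) f
  else false.

Variable images : lform -> seq lform.

(** A coincidence [f = g f'] vanishes when [g] or [f'] does. Once both cases are treated, [f'] and
    its [images] join the forms dealt with, which prunes the remaining coincidences. *)
Fixpoint branch m pts (fs : seq lform) (s : forms) (ps : seq Z) : bool :=
  if fs is f :: fs' then
    if normalize m f is Some (g, f') then
      let qs := new_primes m ps g in
      if all (enter_char pts s None) qs then
        let ps' := qs ++ ps in
        if known f' s then branch m pts fs' s ps'
        else if impose m pts s ps' f' then
          branch m pts fs' (foldr insert s (f' :: images f')) ps'
        else false
      else false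
    else false
  else true.

End Branch.

(** * Testing for the three families; the search proper *)

Definition combination m (o : lform) (a : Z) (x : lform) (b : Z) (y : lform) : lform :=
  reduce m (zipf Z.add o (zipf (fun s t => a * s + b * t) x y)).

(** Three of the points serve as the origin and the ends of two direction vectors; the pattern they
    span must then contain all the points. *)
Definition covered m (pts : seq lform) (f : lform -> lform -> lform -> seq lform) : bool :=
  has (fun o => has (fun p => has (fun q =>
    all (fun v => vmem v (f o (vsub m p o) (vsub m q o))) pts) pts) pts) pts.

Definition recognize (m : Z) (pts : seq lform) : bool :=
  if m =? 7 then
    covered m pts (fun o x y => [seq combination m o c.1 x c.2 y |
      c <- [:: (0, 0); (1, 0); (1, 2); (1, 3); (0, 1); (0, 2); (0, 4)]])
  else if m =? 17 then
    covered m pts (fun o x _ =>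
      [seq combination m o c x 0 x | c <- [:: 0; 1; 2; 3; 5; 6; 14]])
  else if m =? 19 then
    covered m pts (fun o x _ =>
      [seq combination m o c x 0 x | c <- [:: 0; 1; 2; 3; 8; 10; 13]])
  else false.

(* [s] holds forms, and [ps] primes, whose vanishing was already dealt with. *)
Fixpoint search (closed : Z -> seq lform -> bool) (fuel : nat)
    (m : Z) (pts : seq lform) (s : forms) (ps : seq Z) : bool :=
  if fuel is fuel'.+1 then
    if closed m pts then true
    else
      let k := (size (sums m pts))./2 in
      let ds := take k (diffs m pts) in
      if size ds == k then
        branch (search closed fuel') (fun=> [::]) m pts
          (collisions m ds) s ps
      else recognize m pts
  else false.

Definition compose (tm : seq lform) (v : lform) : lform :=
  foldr (zipf Z.add) [::] [seq map (Z.mul av.1) av.2 | av <- zip v tm].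

(* Substituting [tm] for the parameters only permutes and translates the points,
   so it carries an equation already dealt with to another such equation. *)
Definition symmetry m pts (tm : seq lform) : bool :=
  let qs := map (fun p => reduce m (compose tm p)) pts in
  has (fun p' =>
    let t := vsub m p' (head [::] qs) in
    all (fun p => vmem p (map (vadd m t) qs)) pts) pts.

Definition symmetry_images m (syms : seq (seq lform)) (f : lform) : seq lform :=
  pmap (fun tm => omap snd (normalize m (reduce m (compose tm f)))) syms.

(** The first forms dealt with are the differences of the points, nonzero because the points are
    distinct. Symmetries are used at this level only: an elimination may destroy them. *)
Definition root_search closed (syms : seq (seq lform)) (m : Z) (pts : seq lform) : bool :=
  let k := (size (sums m pts))./2 in
  let ds := take k (diffs m pts) in
  if all (symmetry m pts) syms then
    if normalize_all m (diffs m pts) no_forms is Some s then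
      if size ds == k then
        branch (search closed 12) (symmetry_images m syms)
          m pts (collisions m ds) s [::]
      else false
    else false
  else false.

(** * Patterns that close a branch *)

Definition ap4 m (pts : seq lform) : bool :=
  has (fun a => has (fun b =>
    if veq a b then false else
    let d := vsub m b a in
    let c := vadd m b d in
    if vmem c pts then
      if veq c a then false else
      let e := vadd m c d in if veq e a then false else vmem e pts
    else false) pts) pts.

Definition ap3_pair m (pts : seq lform) : bool :=
  has (fun a => has (fun b =>
    if veq a b then false else
    let d := vsub m b a in
    let c := vadd m b d in
    if vmem c pts then
      if veq c a then false else
      has (fun u => if vmem u [:: a; b; c] then false else
        let v := vadd m u d in
        if vmem v pts then negb (vmem v [:: a; b; c]) else false) pts
    else false) pts) pts.

(** The pairs [{p, p + d}] may overlap here; [thrice_classified] sorts out the overlaps. *)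
Definition thrice m (pts : seq lform) : bool :=
  has (fun a => has (fun b =>
    if veq a b then false else
    let d := vsub m b a in
    leq 3 (count (fun p => vmem (vadd m p d) pts) pts)) pts) pts.

(** * Initial configurations and their symmetries *)

Definition root_4ap : seq lform :=
  [:: [:: 0;0;0;0]; [:: 1;0;0;0]; [:: 2;0;0;0]; [:: 3;0;0;0];
      [:: 0;1;0;0]; [:: 0;0;1;0]; [:: 0;0;0;1]].
(** The six permutations of the free points, then the same six with the progression reversed: [x]
    becomes [-x] and the free points move by [-3x], so that a translation by [3x] restores the
    configuration. *)
Definition sym_4ap : seq (seq lform) :=
  let y := [:: 0;1;0;0] in let z := [:: 0;0;1;0] in let w := [:: 0;0;0;1] in
  let y' := [:: -3;1;0;0] in let z' := [:: -3;0;1;0] in let w' := [:: -3;0;0;1] in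
  let x := [:: 1;0;0;0] in let x' := [:: -1;0;0;0] in
  [:: [:: x; y; z; w]; [:: x; y; w; z]; [:: x; z; y; w]; [:: x; z; w; y];
      [:: x; w; y; z]; [:: x; w; z; y];
      [:: x'; y'; z'; w']; [:: x'; y'; w'; z']; [:: x'; z'; y'; w'];
      [:: x'; z'; w'; y']; [:: x'; w'; y'; z']; [:: x'; w'; z'; y']].

Definition root_ap3_pair : seq lform :=
  [:: [:: 0;0;0;0]; [:: 1;0;0;0]; [:: 2;0;0;0];
      [:: 0;1;0;0]; [:: 1;1;0;0]; [:: 0;0;1;0]; [:: 0;0;0;1]].
(** Exchange of the two free points, and reversal of the common difference, undone by a translation
    by [2x]. *)
Definition sym_ap3_pair : seq (seq lform) :=
  let x := [:: 1;0;0;0] in let y := [:: 0;1;0;0] in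
  let z := [:: 0;0;1;0] in let w := [:: 0;0;0;1] in
  let x' := [:: -1;0;0;0] in let y' := [:: -1;1;0;0] in
  let z' := [:: -2;0;1;0] in let w' := [:: -2;0;0;1] in
  [:: [:: x; y; z; w]; [:: x; y; w; z]; [:: x'; y'; z'; w']; [:: x'; y'; w'; z']].

Definition root_pairs : seq lform :=
  [:: [:: 0;0;0;0]; [:: 1;0;0;0]; [:: 0;1;0;0]; [:: 1;1;0;0];
      [:: 0;0;1;0]; [:: 1;0;1;0]; [:: 0;0;0;1]].
Definition root_line : seq lform :=
  [:: [:: 0;0;0;0;0]; [:: 1;0;0;0;0]; [:: 2;0;0;0;0];
      [:: 0;1;0;0;0]; [:: 0;0;1;0;0]; [:: 0;0;0;1;0]; [:: 0;0;0;0;1]].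
(** The centre of symmetry is translated to 0. *)
Definition root_sym6 : seq lform :=
  [:: [:: 1;0;0;0]; [:: -1;0;0;0]; [:: 0;1;0;0]; [:: 0;-1;0;0];
      [:: 0;0;1;0]; [:: 0;0;-1;0]; [:: 0;0;0;1]].

End Computation.

(** * Evaluation of forms *)

Lemma veqE (u v : lform) : veq u v = (u == v).
Proof.
elim: u v => [|a u IHu] [|b v] //=; rewrite eqseq_cons -IHu.
by have -> : Z.eqb a b = (a == b) by []; case: eqP.
Qed.

Lemma vmemE (v : lform) s : vmem v s = (v \in s).
Proof.
rewrite /vmem -has_pred1; apply: eq_has => u /=.
by rewrite veqE eq_sym.
Qed.

Lemma mem_dedup (seen s : seq lform) v :
  v \in s -> (v \in seen) || (v \in dedup seen s).
Proof.
elim: s seen => //= u s IHs seen; rewrite inE => /predU1P[->|/IHs vs].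
  by rewrite vmemE; case: ifP => // _; rewrite mem_head orbT.
rewrite vmemE; case: ifP => [//|useen].
by have := vs (u :: seen); rewrite !inE -orbA orbCA.
Qed.

Lemma dedup_sub (seen s : seq lform) : {subset dedup seen s <= s}.
Proof.
elim: s seen => //= u s IHs seen v; rewrite vmemE inE; case: ifP => _.
  by move/IHs->; rewrite orbT.
by rewrite inE => /predU1P[->|/IHs->]; rewrite ?eqxx ?orbT.
Qed.

Lemma all_prior_pairs (T U : Type) (P : pred U) (f : T -> T -> seq U) seen s :
  all P (prior_pairs f seen s) =
  allrel (fun x y => all P (f y x)) seen s && pairwise (fun x y => all P (f y x)) s.
Proof.
elim: s seen => [|x s IHs] seen /=; first by rewrite allrel0r.
have flattenP : all P (flatten (map (f x) seen)) = all (fun y => all P (f x y)) seen.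
  by elim: seen {IHs} => //= y seen IH; rewrite all_cat IH.
rewrite all_cat flattenP IHs -cats1 allrel_catl allrel_consr {2}/allrel /= andbT.
by rewrite !andbA.
Qed.

Section Eval.

Variable F : fieldType.

Definition zr (z : Z) : F := (ssrZ.int_of_Z z)%:~R.

Lemma zr0 : zr 0 = 0. Proof. by []. Qed.
Lemma zr1 : zr 1 = 1. Proof. by []. Qed.
Lemma zrD a b : zr (Z.add a b) = zr a + zr b.
Proof. by rewrite /zr (rmorphD ssrZ.int_of_Z) rmorphD. Qed.
Lemma zrN a : zr (Z.opp a) = - zr a.
Proof. by rewrite /zr (rmorphN ssrZ.int_of_Z) rmorphN. Qed.
Lemma zrB a b : zr (Z.sub a b) = zr a - zr b.
Proof. by rewrite -Z.add_opp_r zrD zrN. Qed.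
Lemma zrM a b : zr (Z.mul a b) = zr a * zr b.
Proof. by rewrite /zr (rmorphM ssrZ.int_of_Z) rmorphM. Qed.

Fixpoint eval (v : lform) (X : seq F) : F :=
  match v, X with
  | a :: v', x :: X' => zr a * x + eval v' X'
  | _, _ => 0
  end.

Lemma eval_nil v : eval v [::] = 0. Proof. by case: v. Qed.

Lemma eval_map (op : Z -> Z) (a : F) v X :
  (forall x, zr (op x) = a * zr x) -> eval (map op v) X = a * eval v X.
Proof.
move=> opP; elim: v X => [|b v IHv] [|x X] /=; rewrite ?mulr0 //.
by rewrite opP IHv mulrDr mulrA.
Qed.

Lemma eval_zipf (op : Z -> Z -> Z) (a b : F) u v X :
    (forall x y, zr (op x y) = a * zr x + b * zr y) ->
  eval (zipf op u v) X = a * eval u X + b * eval v X.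
Proof.
move=> opP; elim: u v X => [|c u IHu] [|d v] X.
- by case: X => //=; rewrite !mulr0 addr0.
- rewrite (_ : zipf _ _ _ = map (op Z0) (d :: v)) //.
  by rewrite (@eval_map _ b) ?mulr0 ?add0r // => x; rewrite opP mulr0 add0r.
- rewrite (_ : zipf _ _ _ = map (op^~ Z0) (c :: u)) //.
  by rewrite (@eval_map _ a) ?mulr0 ?addr0 // => x; rewrite opP mulr0 addr0.
- case: X => [|x X] /=; first by rewrite !mulr0 addr0.
  by rewrite opP IHu; ring.
Qed.

Lemma zr_mod m a : zr m = 0 -> zr (Z.modulo a m) = zr a.
Proof.
by move=> m0; rewrite [in RHS](Z_div_mod_eq_full a m) zrD zrM m0 mul0r add0r.
Qed.

Section Modulus.

Variable m : Z.
Hypothesis m0 : zr m = 0.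

Lemma eval_reduce v X : eval (reduce m v) X = eval v X.
Proof.
rewrite /reduce; case: ifP => // _.
by rewrite (@eval_map _ 1) ?mul1r // => x; rewrite mul1r zr_mod.
Qed.

Lemma eval_vsub u v X : eval (vsub m u v) X = eval u X - eval v X.
Proof.
rewrite eval_reduce (@eval_zipf _ 1 (- 1)) ?mul1r ?mulN1r // => x y.
by rewrite zrB mul1r mulN1r.
Qed.

Lemma eval_vadd u v X : eval (vadd m u v) X = eval u X + eval v X.
Proof.
rewrite eval_reduce (@eval_zipf _ 1 1) ?mul1r // => x y.
by rewrite zrD !mul1r.
Qed.

Lemma eval_up_to_sign v X : exists b : bool, eval (up_to_sign m v) X = (-1) ^+ b * eval v X.
Proof.
rewrite /up_to_sign; case: ifP => _; last by exists false; rewrite mul1r.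
exists true; rewrite eval_reduce (@eval_map _ (- 1)) // => x.
by rewrite zrN mulN1r.
Qed.

Lemma eval_remove i v Y :
  eval v Y = zr (nth Z0 v i) * nth 0 Y i + eval (remove i v) (remove i Y).
Proof.
elim: i v Y => [|i IHi] [|a v] [|y Y] //=;
  rewrite ?mul0r ?mulr0 ?addr0 ?add0r ?nth_nil ?mulr0 ?mul0r ?add0r //.
- by rewrite eval_nil.
- by rewrite addrCA -IHi.
Qed.

Lemma eval_eliminate i (f v : lform) X :
    eval f X = 0 ->
  eval (eliminate m i (nth Z0 f i) f v) (remove i X) = zr (nth Z0 f i) * eval v X.
Proof.
move=> f0; rewrite /eliminate.
have [fE vE] := (eval_remove i f X, eval_remove i v X).
set c := nth Z0 f i in fE *; set b := nth Z0 v i in vE *; rewrite eval_reduce.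
have -> : zr c * eval v X =
          zr c * eval (remove i v) (remove i X) - zr b * eval (remove i f) (remove i X).
  move: fE; rewrite f0 vE => /esym/eqP; rewrite addr_eq0 => /eqP cX.
  rewrite -[RHS]opprK -(opprK (eval (remove i f) _)) -cX; ring.
case: Z.eqb_spec => [-> | _]; rewrite ?mul0r ?subr0.
  case: Z.eqb_spec => [-> | _]; first by rewrite mul1r.
  by rewrite (@eval_map _ (zr c)) // => x; rewrite zrM.
rewrite (@eval_zipf _ (zr c) (- zr b)) ?mulNr // => x y.
by rewrite zrB !zrM mulNr.
Qed.

Lemma lead_eq0 v X : lead v = Z0 -> eval v X = 0.
Proof.
elim: v X => [|a v IHv] [|x X] //=; case: Z.eqb_spec => [-> v0|//].
by rewrite mul0r add0r IHv.
Qed.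

Lemma dvd_content g v :
  Z.divide g (content v) -> all (fun a => Z.eqb (Z.modulo a g) Z0) v.
Proof.
elim: v => //= a v IHv gdvd; apply/andP; split.
  have [k ->] : Z.divide g a by apply: Z.divide_trans gdvd (Z.gcd_divide_l _ _).
  by rewrite Z_mod_mult.
exact/IHv/(Z.divide_trans _ _ _ gdvd)/Z.gcd_divide_r.
Qed.

(** In a fixed characteristic the scalar is invertible, so the vanishing of [v] forces that of [v'];
    for [m = 0] the scalar may vanish in [F], and its factors become separate cases. *)
Lemma normalizeP v X :
  if normalize m v is Some (g, v') then
    eval v X = zr g * eval v' X /\ (m <> Z0 -> zr g != 0)
  else eval v X = 0.
Proof.
rewrite /normalize; cbv zeta; case: (Z.eqb_spec (lead v) Z0) => [v0|_]; first exact: lead_eq0.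
case: Z.eqb_spec => [-> | m_neq0]; last first.
  set k := inverse_from _ _ _ _.
  case: (Z.eqb_spec _ (Zpos xH)) => [ka|_]; last by rewrite mul1r oner_neq0.
  have ak1 : zr (lead v) * zr k = 1.
    by rewrite -zrM Z.mul_comm -(zr_mod _ m0) ka.
  split=> [|_]; last by apply: contra_eq_neq ak1 => ->; rewrite mul0r eq_sym oner_neq0.
  rewrite (@eval_map _ (zr k)) => [|x]; last by rewrite zr_mod // zrM.
  by rewrite mulrA ak1 mul1r.
set g := (if Z.ltb _ _ then _ else _); case: ifP => _; first by rewrite mul1r.
split=> //; have : all (fun a => Z.eqb (Z.modulo a g) Z0) v.
  apply: dvd_content; rewrite {}/g; case: ifP => _; last exact: Z.divide_refl.
  by apply/Z.divide_opp_l/Z.divide_refl.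
elim: v X {g}(g) => [|a v IHv] [|x X] g //=; rewrite ?mulr0 //.
case/andP=> /Z.eqb_spec a0 vg; rewrite (IHv _ g) // mulrDr mulrA -zrM.
by rewrite [in LHS](Z_div_mod_eq_full a g) a0 Z.add_0_r.
Qed.

(** A field has no zero divisors, so each division splits off a factor that vanishes or leaves a
    quotient that does; the leftover cofactor counts as a factor. *)
Lemma factor_fromP fuel p n :
  Z.lt Z0 p -> zr n = 0 -> has (fun q => zr q == 0) (factor_from fuel p n).
Proof.
elim: fuel p n => [|fuel IHfuel] p n p_gt0 /= n0; first by rewrite n0 eqxx.
case: (Z.eqb_spec n _) => [n1|_]; first by have := oner_neq0 F; rewrite -zr1 -n1 n0 eqxx.
case: (Z.eqb_spec _ Z0) => [np|_]; last by apply: IHfuel => //; lia.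
have : zr p * zr (Z.div n p) = 0.
  by rewrite -zrM -n0 [in RHS](Z_div_mod_eq_full n p) np Z.add_0_r.
move/eqP; rewrite mulf_eq0 => /orP[p0|/eqP/(IHfuel p _ p_gt0) has0]; last first.
  by case: ifP; rewrite /= ?has0 ?orbT.
case: (Z.eqb_spec _ p) => [rp|_]; last by rewrite /= p0.
case: (factor_from fuel p _) rp => [/= p_eq0|q r /= ->]; last by rewrite p0.
by rewrite -p_eq0 in p_gt0.
Qed.

Hypothesis two_neq0 : (2 : F) != 0.

Lemma odd_factorsP n : zr n = 0 -> exists2 q, q \in odd_factors n & zr q = 0.
Proof.
move=> n0; have : zr (Z.abs n) = 0.
  by case: (Z.abs_spec n) => -[_ ->] //; rewrite zrN n0 oppr0.
case/(@factor_fromP 64 (Zpos 2) _ erefl)/hasP => q qn /eqP q0.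
exists q; rewrite // mem_filter qn andbT.
by case: Z.eqb_spec => // q2; move: two_neq0; rewrite -q0 q2 eqxx.
Qed.

Lemma new_primesP ps n :
    zr n = 0 -> (m = Z0) ->
  exists2 q, q \in new_primes m ps n ++ ps & zr q = 0.
Proof.
move=> n0 ->; have [q qn q0] := odd_factorsP n0; exists q => //.
rewrite mem_cat mem_filter qn andbT orbC.
have -> : has (Z.eqb q) ps = (q \in ps).
  by rewrite -has_pred1; apply: eq_has => r; rewrite /= eq_sym.
by case: (q \in ps).
Qed.

End Modulus.

Lemma mem_trie_add v t p u q :
  u \in trie_get (trie_add v t p) q -> (u == v) || (u \in trie_get t q).
Proof.
elim: p t q => [p IHp|p IHp|] [|l b r] [q|q|] //=.
all: try by move=> ->; rewrite orbT.
all: try exact: IHp.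
all: by rewrite ?in_nil ?inE.
Qed.

Definition all_forms (P : lform -> Prop) (s : forms) : Prop :=
  (forall v, v \in form_seq s -> P v) /\ (forall p v, v \in trie_get (form_trie s) p -> P v).

Lemma all_forms_known P v s : all_forms P s -> known v s -> P v.
Proof. by case=> _ Ps; rewrite /known vmemE => /Ps. Qed.

Lemma all_forms_insert (P : lform -> Prop) v s : P v -> all_forms P s -> all_forms P (insert v s).
Proof.
move=> Pv [Pl Pt]; rewrite /insert; case: ifP => // _; split=> [u|p u] /=.
  by rewrite inE => /predU1P[->|/Pl].
by case/mem_trie_add/predU1P=> [->|/Pt].
Qed.

Lemma all_forms_no (P : lform -> Prop) : all_forms P no_forms.
Proof. by split=> // -[]. Qed.

(** The implication [eval v X = 0 -> C] says that [v] is dealt with for the goal [C]. A form of [vs]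
    that normalizes to [None] does vanish at [X], so it yields [C] at once. *)
Lemma normalize_allP (C : Prop) m vs s (X : seq F) :
    zr m = 0 :> F -> (forall v, v \in vs -> eval v X = 0 -> C) ->
    all_forms (fun v => eval v X = 0 -> C) s ->
  if normalize_all m vs s is Some s' then all_forms (fun v => eval v X = 0 -> C) s'
  else C.
Proof.
move=> m0; elim: vs s => //= v vs IHvs s Cvs Cs.
have := normalizeP m0 v X; case: normalize => [[g v'] [vE _]|v0]; last first.
  exact: Cvs (mem_head _ _) v0.
apply: IHvs => [u uvs|]; first by apply: Cvs; rewrite inE uvs orbT.
apply: all_forms_insert => // v'0.
by apply: (Cvs v); rewrite ?mem_head // vE v'0 mulr0.
Qed.

End Eval.

(** * Affine invariance and branching *)

Section Affine.

Variable F : fieldType.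
Implicit Types (A : {fset F}) (x y : F).

Definition mstd_type A : Prop :=
  [\/ exists (char7 : 7%N \in [pchar F]) (a b : F),
        prime_lin_indep2 char7 a b /\
        affinely_equivalent A
          [fset 0; a; a + 2 * b; a + 3 * b; b; 2 * b; 4 * b],
      17%N \in [pchar F] /\
        affinely_equivalent A [fset 0; 1; 2; 3; 5; 6; 14]
    | 19%N \in [pchar F] /\
        affinely_equivalent A [fset 0; 1; 2; 3; 8; 10; 13]].

Definition classified A : Prop := MSTD A -> mstd_type A.

Lemma affine_image_comp x y u v A :
  affine_image u v (affine_image x y A) = affine_image (u * x) (u * y + v) A.
Proof.
rewrite /affine_image; apply/fsetP=> z; apply/imfsetP/imfsetP => /=.
  by case=> _ /imfsetP[a aA ->] ->; exists a; rewrite // mulrDr mulrA addrA.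
case=> a aA ->; exists (x * a + y); first exact: in_imfset.
by rewrite mulrDr mulrA addrA.
Qed.

Lemma affine_image_id A : affine_image 1 0 A = A.
Proof.
apply/fsetP=> z; apply/imfsetP/idP => /= [[a aA ->]|zA].
  by rewrite mul1r addr0.
by exists z; rewrite // mul1r addr0.
Qed.

Lemma affine_imageK x y A :
  x != 0 -> affine_image x^-1 (- (x^-1 * y)) (affine_image x y A) = A.
Proof. by move=> x0; rewrite affine_image_comp mulVf // subrr affine_image_id. Qed.

Lemma card_affine_image x y A : x != 0 -> #|` affine_image x y A| = #|` A|.
Proof. by move=> x0; apply: card_imfset => a b /addIr/(mulfI x0). Qed.

Lemma sumset_affine x y A :
  sumset (affine_image x y A) = affine_image x (y + y) (sumset A).
Proof.
apply/fsetP=> z; apply/imfset2P/imfsetP => /=.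
  case=> _ /imfsetP[a aA ->] [_ /imfsetP[b bA ->] ->].
  by exists (a + b); [exact: in_imfset2 | rewrite /= mulrDr addrACA].
case=> _ /imfset2P[a aA [b bA ->]] ->.
exists (x * a + y); first exact: in_imfset.
by exists (x * b + y); [exact: in_imfset | rewrite /= mulrDr addrACA].
Qed.

Lemma diffset_affine x y A :
  diffset (affine_image x y A) = affine_image x 0 (diffset A).
Proof.
apply/fsetP=> z; apply/imfset2P/imfsetP => /=.
  case=> _ /imfsetP[a aA ->] [_ /imfsetP[b bA ->] ->].
  by exists (a - b); [exact: in_imfset2 | rewrite /=; ring].
case=> _ /imfset2P[a aA [b bA ->]] ->.
exists (x * a + y); first exact: in_imfset.
by exists (x * b + y); [exact: in_imfset | rewrite /=; ring].
Qed.

Lemma MSTD_affine x y A : x != 0 -> MSTD (affine_image x y A) <-> MSTD A.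
Proof.
by move=> x0; rewrite /MSTD sumset_affine diffset_affine !card_affine_image.
Qed.

Lemma affinely_equivalent_affine x y A B :
  x != 0 -> affinely_equivalent (affine_image x y A) B -> affinely_equivalent A B.
Proof.
move=> x0 [u [v [u0 AB]]].
exists (x^-1 * u), (x^-1 * v - x^-1 * y); split; first by rewrite mulf_neq0 ?invr_eq0.
by rewrite -affine_image_comp -AB affine_imageK.
Qed.

Lemma classified_affine x y A :
  x != 0 -> classified (affine_image x y A) -> classified A.
Proof.
move=> x0 cA /(MSTD_affine y A x0)/cA [[char7 [a [b [ab A_ab]]]]|[p17 AB]|[p19 AB]].
- apply: Or31; exists char7, a, b; split=> //; exact: affinely_equivalent_affine A_ab.
- apply: Or32; split=> //; exact: affinely_equivalent_affine AB.
- apply: Or33; split=> //; exact: affinely_equivalent_affine AB.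
Qed.

End Affine.

(** * Soundness of one branching step *)

Section Soundness.

Variable F : fieldType.
Hypothesis two_neq0 : (2 : F) != 0.

Notation zr := (@zr F).

Definition values (pts : seq lform) (X : seq F) : seq F := [seq eval p X | p <- pts].
Definition value_set pts X : {fset F} := [fset x in values pts X].
Definition generic pts X := uniq (values pts X) && (size pts == 7%N).

Definition excludes (C : Prop) (X : seq F) (s : forms) :=
  all_forms (fun v => eval v X = 0 -> C) s.

(* The goal [C] stays fixed while points are rescaled and parameters dropped. *)
Definition sound (go : state_check) : Prop :=
  forall m pts s ps X (C : Prop), zr m = 0 -> generic pts X ->
    (classified (value_set pts X) -> C) -> excludes C X s ->
    (forall q, q \in ps -> zr q = 0 -> C) -> go m pts s ps -> C.

Lemma values_scale c pts pts' X X' :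
    {in pts, forall p, eval (pts' p) X' = c * eval p X} ->
  values (map pts' pts) X' = [seq c * x | x <- values pts X].
Proof. by move=> ptsE; rewrite /values -!map_comp; apply/(proj1 (eq_in_map _ _ _)). Qed.

Lemma value_set_scale c pts pts' X X' :
    {in pts, forall p, eval (pts' p) X' = c * eval p X} ->
  value_set (map pts' pts) X' = affine_image c 0 (value_set pts X).
Proof.
move=> /values_scale ptsE; apply/fsetP=> z.
rewrite inE /= ptsE; apply/mapP/imfsetP => /=.
  by case=> a aX ->; exists a; rewrite ?inE ?addr0.
by case=> a; rewrite inE /= => aX ->; exists a; rewrite ?addr0.
Qed.

Lemma generic_scale c pts pts' X X' : c != 0 ->
    {in pts, forall p, eval (pts' p) X' = c * eval p X} ->
  generic pts X -> generic (map pts' pts) X'.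
Proof.
move=> c0 /values_scale ptsE /andP[uX sz]; rewrite /generic size_map sz andbT ptsE.
by rewrite map_inj_uniq // => a b /(mulfI c0).
Qed.

Section Go.

Variable go : state_check.
Hypothesis go_sound : sound go.

Section State.

Variables (pts : seq lform) (s : forms) (X : seq F) (C : Prop).
Hypothesis gX : generic pts X.
Hypothesis clsC : classified (value_set pts X) -> C.
Hypothesis sC : excludes C X s.

Lemma substituteP m ps f : zr m = 0 -> eval f X = 0 ->
    (forall q, q \in ps -> zr q = 0 -> C) ->
    (m = Z0 -> zr (nth Z0 f (pivot f)) = 0 -> C) ->
  substitute go m pts s ps f -> C.
Proof.
move=> m0 f0 psC cC; rewrite /substitute.
set i := pivot f; set c := nth _ f i in cC *.
case: ifP => // c1.
(* If the pivot coefficient vanishes, [cC] gives the goal for [m = 0]; otherwise the test [c = 1] is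
   contradicted. *)
case: (eqVneq (zr c) 0) => [c0|c0].
  move: c1; case: Z.eqb_spec => [/cC|_]; first by move/(_ c0).
  by case: Z.eqb_spec => // c1; have := oner_neq0 F; rewrite -zr1 -c1 c0 eqxx.
(* Dropping the parameter scales every point by [zr c], an affine change of the set. *)
have elimE v : eval (eliminate m i c f v) (remove i X) = zr c * eval v X.
  exact: eval_eliminate.
have elim0 v : eval (eliminate m i c f v) (remove i X) = 0 -> eval v X = 0.
  by move=> /eqP; rewrite elimE mulf_eq0 (negPf c0) => /eqP.
have /(_ (map (eliminate m i c f) (form_seq s)) no_forms) := @normalize_allP F C m _ _ (remove i X) m0.
case: normalize_all => [s'|] noC.
  apply: (go_sound m0 _ _ _ psC).
  - by apply: (generic_scale c0 _ gX) => p _; apply: elimE.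
  - move=> cls; apply: clsC; apply: (@classified_affine _ (zr c) 0) => //.
    by rewrite -(@value_set_scale _ _ (eliminate m i c f) _ (remove i X)).
  - apply: noC; last exact: all_forms_no.
    by move=> _ /mapP[v vs ->] /elim0; apply: (proj1 sC).
move=> _; apply: noC; last exact: all_forms_no.
by move=> _ /mapP[v vs ->] /elim0; apply: (proj1 sC).
Qed.

End State.

Lemma enter_charP pts s X (C : Prop) extra q :
    generic pts X -> (classified (value_set pts X) -> C) -> excludes C X s ->
    zr q = 0 -> (forall f, extra = Some f -> eval f X = 0) ->
  enter_char go pts s extra q -> C.
Proof.
move=> gX clsC sC q0 extra0; rewrite /enter_char.
case: Z.eqb_spec => // q_neq0.
have redE p : eval (reduce q p) X = 1 * eval p X by rewrite mul1r eval_reduce.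
have /(_ (map (reduce q) (form_seq s)) no_forms) := @normalize_allP F C q _ _ X q0.
have exC : forall v, v \in map (reduce q) (form_seq s) -> eval v X = 0 -> C.
  by move=> _ /mapP[v vs ->]; rewrite redE mul1r; apply: (proj1 sC).
move=> /(_ exC (all_forms_no _)).
case: normalize_all => [s' s'C|//].
have gX' : generic (map (reduce q) pts) X.
  by apply: (generic_scale (oner_neq0 F) _ gX) => p _; apply: redE.
have clsC' : classified (value_set (map (reduce q) pts) X) -> C.
  by rewrite (@value_set_scale 1 _ _ X) // affine_image_id.
have go_q : go q (map (reduce q) pts) s' [::] -> C.
  by apply: (go_sound q0 gX' clsC') => [|r]; [exact: s'C|rewrite in_nil].
case: extra extra0 => [f|] //= /(_ f erefl) f0.
have := normalizeP q0 (reduce q f) X; case: normalize => [[g f'] [fE g0]|_] //.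
have f'0 : eval f' X = 0.
  apply/eqP; have := mulf_eq0 (zr g) (eval f' X).
  by rewrite -fE redE mul1r f0 eqxx (negPf (g0 q_neq0)).
have s'C' : excludes C X s' by apply: s'C.
case: ifP => [/(all_forms_known s'C')/(_ f'0)|_] //.
by apply: (substituteP gX' clsC' s'C' q0 f'0) => [r|/q_neq0]; rewrite ?in_nil.
Qed.

Lemma imposeP m pts s X (C : Prop) ps f :
    zr m = 0 -> generic pts X -> (classified (value_set pts X) -> C) ->
    excludes C X s -> (forall q, q \in ps -> zr q = 0 -> C) -> eval f X = 0 ->
  impose go m pts s ps f -> C.
Proof.
move=> m0 gX clsC sC psC f0; rewrite /impose; case: ifP => // /allP qsP.
set qs := new_primes _ _ _ in qsP *.
have qsC q : q \in qs ++ ps -> zr q = 0 -> C.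
  rewrite mem_cat => /orP[/qsP enter_q q0|/psC//].
  by apply: (enter_charP gX clsC sC q0 _ enter_q) => _ [<-].
apply: (substituteP gX clsC sC m0 f0 qsC) => m_eq0 c0.
by have [q /qsC] := new_primesP two_neq0 ps c0 m_eq0; apply.
Qed.

Variable images : lform -> seq lform.

(** The goal depends on [X], and each form is settled for all [X] in [G] at once: a symmetry moves
    the parameters, so excluding an image of [f] at one [X] uses the result for [f] at another. *)
Lemma branchP m pts (G : seq F -> Prop) (C : seq F -> Prop) fs s ps :
    zr m = 0 -> (forall X, G X -> generic pts X) ->
    (forall X, G X -> classified (value_set pts X) -> C X) ->
    (forall X, G X -> excludes (C X) X s) ->
    (forall q, q \in ps -> zr q = 0 -> forall X, G X -> C X) ->
    (forall f, (forall X, G X -> eval f X = 0 -> C X) ->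
       {in images f, forall f' X, G X -> eval f' X = 0 -> C X}) ->
    branch go images m pts fs s ps ->
  forall X, G X -> {in fs, forall f, eval f X = 0 -> C X}.
Proof.
move=> m0 gen clsC + + imgC; elim: fs s ps => [|f fs IHfs] s ps sC psC //=.
case fE: (normalize m f) => [[g f']|//].
case: ifP => // /allP qsP.
set qs := new_primes _ _ _ in qsP *.
have qsC q : q \in qs ++ ps -> zr q = 0 -> forall X, G X -> C X.
  rewrite mem_cat => /orP[/qsP enter_q q0 X GX|/psC//].
  exact: (enter_charP (gen X GX) (clsC X GX) (sC X GX) q0 _ enter_q).
(* If [f] vanishes but [f'] does not, then [g] vanishes in [F]: impossible in a fixed
   characteristic, and otherwise covered by the factors in [qs ++ ps]. *)
have f'C_fC : (forall X, G X -> eval f' X = 0 -> C X) ->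
    forall X, G X -> eval f X = 0 -> C X.
  move=> f'C X GX f0; have := normalizeP m0 f X; rewrite fE => -[fX g0].
  move/eqP: fX; rewrite f0 eq_sym mulf_eq0 => /orP[/eqP g_eq0|/eqP/f'C]; last exact.
  have [m_eq0|m_neq0] := Z.eq_dec m Z0; last first.
    by have := g0 m_neq0; rewrite g_eq0 eqxx.
  have [q /qsC qC q0] := new_primesP two_neq0 ps g_eq0 m_eq0; exact: (qC q0 X GX).
move=> branch_fs0; suff [f'C [s' s'C branch_fs]] : (forall X, G X -> eval f' X = 0 -> C X) /\
    exists2 s', (forall X, G X -> excludes (C X) X s') & branch go images m pts fs s' (qs ++ ps).
  move=> X GX h; rewrite inE => /predU1P[->|]; first exact: f'C_fC.
  exact: IHfs s'C qsC branch_fs X GX h.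
have imC f0 : f0 \in images f' -> (forall X, G X -> eval f' X = 0 -> C X) ->
    forall X, G X -> eval f0 X = 0 -> C X.
  by move=> f0im /imgC; apply.
case: ifP branch_fs0 => [f'_known branch_fs|_].
  split; last by exists s.
  by move=> X /sC sCX; exact: (all_forms_known sCX f'_known).
case: ifP => // impose_f' branch_fs.
have f'C X : G X -> eval f' X = 0 -> C X.
  by move=> GX f'0; apply: (imposeP m0 (gen X GX) (clsC X GX) (sC X GX) _ f'0 impose_f') => q /qsC qC q0; exact: (qC q0 X GX).
split=> //; exists (foldr insert s (f' :: images f')) => // X GX.
have insC vs : {in vs, forall v, eval v X = 0 -> C X} -> excludes (C X) X (foldr insert s vs).
  elim: vs => [|v vs IHvs] vsC /=; first exact: sC.
  apply: all_forms_insert; first by apply: vsC; rewrite mem_head.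
  by apply: IHvs => u uvs; apply: vsC; rewrite inE uvs orbT.
apply: insC => v; rewrite inE => /predU1P[->|vim]; first exact: f'C.
exact: (imC _ vim f'C X GX).
Qed.

End Go.
End Soundness.

(** * Forced coincidences *)

Lemma pairwise_in (T : eqType) (r : rel T) s :
    {in s, forall x, r x x} -> {in s &, forall x y, r x y -> r y x} ->
  pairwise r s -> {in s &, forall x y, r x y}.
Proof.
move=> r_refl r_sym rs x y xs ys.
pose r' : rel T := fun x y => [&& x \in s & y \in s] ==> r x y.
have r'_refl : reflexive r'.
  by move=> z; apply/implyP => /andP[/r_refl].
have r'_sym : symmetric r'.
  move=> z t; rewrite /r' andbC; case: (boolP (_ && _)) => //= /andP[ts zs].
  by apply/idP/idP; apply: r_sym.
have : pairwise r' s by apply: sub_pairwise rs => z t zt; apply/implyP.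
rewrite pairwise_all2rel // => /allrelP/(_ x y xs ys).
by rewrite /r' xs ys.
Qed.

Section Soundness.

Variable F : fieldType.
Hypothesis two_neq0 : (2 : F) != 0.

Notation zr := (@zr F).

Section State.

Variables (m : Z) (pts : seq lform) (X : seq F).
Hypothesis m0 : zr m = 0.
Hypothesis gX : generic pts X.

Lemma pairwise_generic : pairwise (fun p q => eval p X != eval q X) pts.
Proof.
by case/andP: gX => + _; rewrite /values uniq_pairwise pairwise_map.
Qed.

Lemma mem_values p : p \in pts -> eval p X \in value_set pts X.
Proof. by move=> ppts; rewrite inE; apply/mapP; exists p. Qed.

Lemma card_sumset_leq : (#|` sumset (value_set pts X)| <= size (sums m pts))%N.
Proof.
rewrite -(size_map (fun v => eval v X) (sums m pts)).
apply: uniq_leq_size; first exact: fset_uniq.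
have sumE p q : p \in pts -> q \in pts -> eval p X + eval q X \in map (fun v => eval v X) (sums m pts).
  pose r p q := eval p X + eval q X \in map (fun v => eval v X) (sums m pts).
  pose l := map (fun p => vadd m p p) pts ++
            prior_pairs (fun p q => [:: vadd m p q]) [::] pts.
  have inl v : v \in l -> eval v X \in map (fun v => eval v X) (sums m pts).
    by move/(mem_dedup [::]) => /= vl; apply: map_f.
  apply: (@pairwise_in _ r) => {p q} [p ps|p q _ _|].
  - rewrite /r -(eval_vadd m0); apply: inl.
    by rewrite mem_cat (map_f (fun p => vadd m p p)).
  - by rewrite /r addrC.
  have : all (mem l) (prior_pairs (fun p q => [:: vadd m p q]) [::] pts).
    by apply/allP => v vl; rewrite inE mem_cat vl orbT.
  rewrite all_prior_pairs => /andP[_]; apply: sub_pairwise => p q /=.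
  by rewrite andbT => /inl; rewrite /r eval_vadd // addrC.
move=> _ /imfset2P[a /= aX [b /= bX ->]].
move: aX bX; rewrite !inE => /mapP[p ps ->] /mapP[q qs ->].
exact: sumE.
Qed.

Lemma diffsP d : d \in diffs m pts ->
  [&& eval d X != 0, eval d X \in diffset (value_set pts X)
    & - eval d X \in diffset (value_set pts X)].
Proof.
move/(@dedup_sub [::]); set P := (X in is_true X); move: d @P; apply/allP.
rewrite all_prior_pairs allrel0l /=.
have ptsP : all (mem pts) pts by apply/allP.
apply: sub_in_pairwise ptsP pairwise_generic => p q ps qs pq; rewrite /= andbT.
have [b ->] := eval_up_to_sign m0 (vsub m q p) X; rewrite eval_vsub //.
have pqD : eval p X - eval q X \in diffset (value_set pts X).
  by apply: in_imfset2; apply: mem_values.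
have qpD : eval q X - eval p X \in diffset (value_set pts X).
  by apply: in_imfset2; apply: mem_values.
rewrite mulf_neq0 ?signr_eq0 ?subr_eq0 1?eq_sym //=.
by case: b; rewrite !(expr0, expr1, mulN1r, mul1r, opprK, opprB) ?pqD qpD.
Qed.

(** Let [S] bound the number of sums and [k] be half of it, rounded down. If no two of the [k]
    differences agreed up to sign, then they, their negatives and 0 would be [2k + 1 >= S] distinct
    elements of [A - A]. *)
Lemma MSTD_collision (ds := take (size (sums m pts))./2 (diffs m pts)) :
    MSTD (value_set pts X) -> size ds = (size (sums m pts))./2 ->
  exists2 f, f \in collisions m ds & eval f X = 0.
Proof.
move=> mstd size_ds; suff /hasP[f fds /eqP f0] : has (fun f => eval f X == 0) (collisions m ds).
  by exists f.
apply: contraLR mstd; rewrite -all_predC all_prior_pairs allrel0l /= -leqNgt => ds_pw.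
have dsP d : d \in ds -> d \in diffs m pts by apply: mem_take.
pose es := [seq eval d X | d <- ds].
have es_uniq : uniq es.
  rewrite uniq_pairwise pairwise_map; apply: sub_pairwise ds_pw => d e /=.
  by rewrite andbT eval_vsub // subr_eq0 eq_sym => /andP[].
(* For [d = e] this says that a nonzero difference is not its own negative, as 2 is invertible. *)
have es_opp : {in ds &, forall d e, eval d X + eval e X != 0}.
  apply: (@pairwise_in _ (fun d e => eval d X + eval e X != 0)) => [d /dsP/diffsP/and3P[d0 _ _]||].
  - by rewrite -mulr2n -mulr_natr mulf_neq0.
  - by move=> d e _ _; rewrite addrC.
  - apply: sub_pairwise ds_pw => d e /=.
    by rewrite andbT eval_vadd // addrC => /andP[].
have size_L : size (0 :: es ++ map -%R es) = (size (sums m pts))./2.*2.+1.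
  by rewrite /= size_cat !size_map size_ds addnn.
apply: leq_trans card_sumset_leq _.
apply: (@leq_trans (size (0 :: es ++ map -%R es))).
  by rewrite size_L -[X in (X <= _)%N]odd_double_half -addn1 addnC leq_add2l; case: odd.
apply: uniq_leq_size.
  rewrite /= cat_uniq es_uniq map_inj_uniq ?es_uniq; last exact: oppr_inj.
  rewrite andbT mem_cat negb_or; apply/andP; split; first apply/andP; try split.
  - by apply/negP => /mapP[d /dsP/diffsP/and3P[d0 _ _]] /esym/eqP; apply/negP.
  - apply/negP => /mapP[_ /mapP[d /dsP/diffsP/and3P[d0 _ _] ->]] /esym/eqP.
    by rewrite oppr_eq0; apply/negP.
  - apply/hasPn => _ /mapP[_ /mapP[d dds ->] ->]; apply/negP => /mapP[e eds] /eqP.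
    by rewrite eq_sym -subr_eq0 opprK; apply/negP/es_opp.
move=> z; rewrite in_cons mem_cat => /or3P[/eqP->|/mapP[d /dsP/diffsP/and3P[_ dD _] ->]|] //.
  case/andP: (gX) => _; case ptsE: pts => [//|p pts'] _.
  rewrite -(subrr (eval p X)) -ptsE.
  by apply: in_imfset2; apply: mem_values; rewrite ptsE mem_head.
by case/mapP=> _ /mapP[d /dsP/diffsP/and3P[_ _ dD] ->] ->.
Qed.

End State.
End Soundness.

(** * Soundness of the whole search *)

Section Search.

Variable F : fieldType.
Hypothesis two_neq0 : (2 : F) != 0.

Notation zr := (@zr F).

Lemma eval_inj pts (X : seq F) : generic pts X ->
  {in pts &, forall p q, veq p q = false -> eval p X != eval q X}.
Proof.
move=> gX p q ps qs; rewrite veqE.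
have: (p == q) || (eval p X != eval q X); last by case: eqP.
apply: (@pairwise_in _ (fun p q => (p == q) || (eval p X != eval q X))) ps qs => {p q}.
- by move=> p _; rewrite eqxx.
- by move=> p q _ _; rewrite eq_sym [eval p X == _]eq_sym.
- by apply: sub_pairwise (pairwise_generic gX) => p q ->; rewrite orbT.
Qed.

Definition closed_sound (closed : Z -> seq lform -> bool) : Prop :=
  forall m pts (X : seq F), zr m = 0 -> generic pts X ->
  closed m pts -> classified (value_set pts X).

Lemma search_sound (recP : closed_sound recognize) closed fuel :
  closed_sound closed -> sound F (search closed fuel).
Proof.
move=> closedP; elim: fuel => //= fuel IHfuel m pts s ps X C m0 gX clsC sC psC.
case: ifP => [closed_pts _|_]; first by apply: clsC; apply: closedP closed_pts.
case: ifP => [/eqP size_ds branch_ds|_ rec_pts]; last first.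
  by apply: clsC; apply: recP rec_pts.
case: (boolP (#|` diffset (value_set pts X)| < #|` sumset (value_set pts X)|)%N) => [mstd|not_mstd].
  have [f fds f0] := MSTD_collision two_neq0 m0 gX mstd size_ds.
  (* Below the root no symmetry is used, so [G] can be the single point [X]. *)
  apply: (branchP two_neq0 IHfuel (G := eq X) (C := fun=> C) m0 _ _ _ _ _ branch_ds erefl fds f0).
  - by move=> _ <-.
  - by move=> _ <-.
  - by move=> _ <-.
  - by move=> q qps q0 _ _; apply: psC qps q0.
  - by move=> g _ g'; rewrite in_nil.
by apply: clsC => mstd; rewrite /MSTD in mstd; rewrite mstd in not_mstd.
Qed.

Lemma eval_compose tm v (X : seq F) :
  eval (compose tm v) X = eval v [seq eval t X | t <- tm].
Proof.
rewrite /compose; elim: v tm => [|a v IHv] [|t tm] //=.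
rewrite (@eval_zipf _ _ 1 1) => [|x y]; last by rewrite zrD !mul1r.
by rewrite IHv !mul1r (@eval_map _ _ (zr a)) // => x; rewrite zrM.
Qed.

(** The seven distinct points at [X] lie among the seven translated points at [Y], so the two lists
    agree as sets and the points at [Y] are distinct too. *)
Lemma symmetryP m pts tm (X : seq F) : zr m = 0 -> generic pts X -> symmetry m pts tm ->
  let Y := [seq eval t X | t <- tm] in
  exists t, generic pts Y /\ value_set pts X = affine_image 1 t (value_set pts Y).
Proof.
move=> m0 gX /hasP[p' p's sub_pts] Y.
set qs := [seq _ | p <- pts] in sub_pts; set v := vsub _ _ _ in sub_pts.
have qE p : eval (reduce m (compose tm p)) X = eval p Y.
  by rewrite eval_reduce // eval_compose.
pose t := eval v X; exists t.
have [uX sz] := andP gX.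
pose zs := [seq x + t | x <- values pts Y].
have sub_values : {subset values pts X <= zs}.
  move=> _ /mapP[p ps ->]; have /allP/(_ p ps) := sub_pts.
  rewrite vmemE => /mapP[_ /mapP[q qs' ->] ->]; rewrite eval_vadd // qE addrC.
  by apply/mapP; exists (eval q Y) => //; apply/mapP; exists q.
have leq_sz : (size zs <= size (values pts X))%N.
  by rewrite !size_map.
have uY : uniq zs by apply: leq_size_uniq sub_values leq_sz.
split; first by rewrite /generic sz andbT (map_uniq uY).
have [_ eq_mem] := uniq_min_size uX sub_values leq_sz.
apply/fsetP=> z; rewrite inE eq_mem; apply/mapP/imfsetP => /= -[x].
  by move=> xY ->; exists x; rewrite ?inE ?mul1r.
by rewrite inE => xY ->; exists x; rewrite ?mul1r.
Qed.

Lemma root_sound (recP : closed_sound recognize) closed syms m pts (X : seq F) :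
    closed_sound closed -> root_search closed syms m pts ->
    zr m = 0 -> generic pts X ->
  classified (value_set pts X).
Proof.
move=> closedP + m0 gX; rewrite /root_search.
case: ifP => // /allP symsP.
have nonzero (Y : seq F) : generic pts Y ->
    if normalize_all m (diffs m pts) no_forms is Some s then
      excludes (classified (value_set pts Y)) Y s
    else classified (value_set pts Y).
  move=> gY; apply: normalize_allP => // d.
  by move=> /(diffsP m0 gY)/and3P[/negPf d0 _ _] /eqP; rewrite d0.
case: normalize_all nonzero => [s|] // sP; case: ifP => // /eqP size_ds branch_ds mstd.
have [f fds f0] := MSTD_collision two_neq0 m0 gX mstd size_ds.
apply: (branchP two_neq0 (search_sound recP (fuel := 12) closedP)
  (G := generic pts) (C := fun Y => classified (value_set pts Y))
  m0 _ _ _ _ _ branch_ds gX fds f0) => // {f fds f0 mstd}.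
move=> f f_cls f'.
rewrite /symmetry_images mem_pmap => + Y gY f'0.
case/mapP=> tm /symsP tm_sym.
case nE: (normalize _ _) => [[g f'']|] //= [f'E]; rewrite -{}f'E in nE.
(* The image of [f] vanishes at [Y], so [f] itself vanishes at the parameters moved by [tm], whose
   point set is a translate of the one at [Y]. *)
have [t [gT ->]] := symmetryP m0 gY tm_sym.
apply: (@classified_affine _ 1 (- t)); rewrite ?oner_neq0 //.
rewrite affine_image_comp mulr1 mul1r addrN affine_image_id.
apply: f_cls => //; have := normalizeP m0 (reduce m (compose tm f)) Y.
by rewrite nE f'0 mulr0 eval_reduce // eval_compose => -[].
Qed.

End Search.

(** * Recognizing the three families *)

Section Recognize.

Variable F : fieldType.
Notation zr := (@zr F).

Lemma fset_eq_seq (A : {fset F}) (s : seq F) :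
  {subset A <= s} -> (size s <= #|` A|)%N -> A =i s.
Proof. by move=> As sA; have [] := uniq_min_size (fset_uniq A) As sA. Qed.

Lemma card_diffset_ge (A : {fset F}) : (#|` A| <= #|` diffset A|)%N.
Proof.
have [->|[a aA]] := fset_0Vmem A; first by rewrite cardfs0.
rewrite -(@card_affine_image _ 1 (- a)) ?oner_neq0 //.
apply/fsubset_leq_card/fsubsetP => _ /imfsetP[b /= bA ->].
by rewrite mul1r; apply: in_imfset2.
Qed.

Lemma natr_mod p n : (p%:R = 0 :> F) -> (n %% p)%:R = n%:R :> F.
Proof. by move=> p0; rewrite [in RHS](divn_eq n p) natrD natrM p0 mulr0 add0r. Qed.

(** All sums lie in a translate of the [p] multiples of [e], so [|A + A| <= p = |A| <= |A - A|]. *)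
Lemma line_not_MSTD p (o e : F) (A : {fset F}) : (0 < p)%N -> p%:R = 0 :> F ->
    #|` A| = p -> (forall a, a \in A -> exists n : nat, a = o + n%:R * e) ->
  ~ MSTD A.
Proof.
move=> p_gt0 p0 cardA A_line; apply/negP; rewrite -leqNgt.
apply: leq_trans (card_diffset_ge A).
rewrite cardA -(size_iota 0 p) -(size_map (fun k => o + o + k%:R * e)).
apply: uniq_leq_size; first exact: fset_uniq.
move=> _ /imfset2P[a /= /A_line[i ->] [b /= /A_line[j ->] ->]].
apply/mapP; exists ((i + j) %% p)%N; first by rewrite mem_iota ltn_mod.
by rewrite natr_mod // natrD; ring.
Qed.

(** Seven candidates containing seven elements are exactly those elements. The scale [x] is nonzero,
    as otherwise [A] would be a single point. *)
Lemma cover_affine (zs : seq Z) (A B : {fset F}) o x :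
    #|` A| = 7%N -> {subset A <= [seq o + zr c * x | c <- zs]} -> size zs = 7%N ->
    B =i [seq zr c | c <- zs] ->
  affinely_equivalent A B.
Proof.
move=> cardA A_sub size_zs BE.
have {BE}-> : B = [fset zr c | c in zs].
  apply/fsetP=> z; rewrite BE; apply/mapP/imfsetP => /= -[c czs ->]; by exists c.
have AE : A = affine_image x o [fset zr c | c in zs].
  apply/fsetP=> z; rewrite (fset_eq_seq A_sub) ?size_map ?size_zs ?cardA //.
  apply/mapP/imfsetP => /= [[c czs ->]|[_ /imfsetP[c /= czs ->] ->]].
    by exists (zr c); [apply: in_imfset | rewrite mulrC addrC].
  by exists c; rewrite // mulrC addrC.
exists x, o; split=> //; apply: contra_eq_neq cardA => x0.
rewrite AE x0; have /fsubset_leq_card : affine_image 0 o [fset zr c | c in zs] `<=` [fset o].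
  by apply/fsubsetP=> _ /imfsetP[b _ ->]; rewrite mul0r add0r inE.
by rewrite cardfs1; case: #|` _| => [|[|k]].
Qed.

Definition coefficients7 : seq (nat * nat) :=
  [:: (0, 0); (1, 0); (1, 2); (1, 3); (0, 1); (0, 2); (0, 4)]%N.

(** If [x] and [y] were dependent over the prime field, [A] would lie on a line of seven points and
    could not be MSTD. *)
Lemma cover_plane (A : {fset F}) o x y : #|` A| = 7%N -> 7%:R = 0 :> F ->
    {subset A <= [seq o + (c.1%:R * x + c.2%:R * y) | c <- coefficients7]} ->
  classified A.
Proof.
move=> cardA F7 A_sub mstdA; apply: Or31.
have char7 : 7%N \in [pchar F] by rewrite inE F7 eqxx.
exists char7, x, y; split; last first.
  exists 1, o; split; first exact: oner_neq0.
  apply/fsetP=> z; rewrite (fset_eq_seq A_sub) ?cardA //; apply/idP/imfsetP.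
    move=> /mapP[c c7 ->]; exists (c.1%:R * x + c.2%:R * y); last by rewrite mul1r addrC.
    move: c c7; apply/allP.
    by rewrite /= !inE !mul0r !mul1r !add0r !addr0 !eqxx ?orbT.
  case=> /= a + ->; rewrite mul1r !inE -!orbA.
  by do 6?[case/orP]; move=> /eqP->;
    rewrite !(mul0r, mul1r, add0r, addr0) ?[_ + o]addrC !eqxx ?orbT.
have dep : (exists e (i j : nat), x = i%:R * e /\ y = j%:R * e) -> False.
  case=> e [i [j [xe ye]]]; apply: (@line_not_MSTD 7 o e A) mstdA => // a /A_sub.
  case/mapP=> c _ ->; exists (c.1 * i + c.2 * j)%N.
  by rewrite xe ye natrD !natrM; ring.
move=> c d cd0; have {}cd0 : (c : nat)%:R * x + (d : nat)%:R * y = 0 := cd0.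
have Fp_neq0 (k : 'F_7) : k != 0 -> exists j : nat, j%:R * k%:R = 1 :> F.
  move=> k0; exists (k^-1 : 'F_7); rewrite -natrM -(natr_mod _ F7).
  have /(congr1 (@nat_of_ord _)) := mulVf k0.
  by move=> /= ->.
have [d0|/Fp_neq0[j jd]] := eqVneq d 0; last first.
  (* With [j] inverse to [d], the relation gives [y = - j c x], and 6 stands for -1 modulo 7. *)
  case: dep; exists x, 1%N, (j * 6 * c)%N; split; first by rewrite mul1r.
  have -> : y = j%:R * ((d : nat)%:R * y) by rewrite mulrA jd mul1r.
  move/eqP: cd0; rewrite addrC addr_eq0 => /eqP->; rewrite !natrM.
  have -> : (6%:R : F) = - 1 by apply/eqP; rewrite -subr_eq0 opprK -(natrD _ 6 1) F7.
  by ring.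
split=> //; apply/eqP; case: (eqVneq c 0) => // /Fp_neq0[j jc].
case: dep; exists y, 0%N, 1%N; split; last by rewrite mul1r.
move: cd0; rewrite d0 mul0r addr0 => cx0.
by rewrite -[x]mul1r -jc -mulrA cx0 mulr0.
Qed.

Lemma recognizeP : closed_sound F recognize.
Proof.
move=> m pts X m0 gX rec_pts.
have cardA : #|` value_set pts X| = 7%N.
  by case/andP: gX => uX /eqP sz; rewrite card_fseq undup_id // size_map.
have combE o a x b y :
    eval (combination m o a x b y) X = eval o X + (zr a * eval x X + zr b * eval y X).
  rewrite eval_reduce // (@eval_zipf _ _ 1 1) => [|s t]; last by rewrite zrD !mul1r.
  by rewrite !mul1r (@eval_zipf _ _ (zr a) (zr b)) // => s t; rewrite zrD !zrM.
have coverP f : covered m pts f ->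
    exists o x y, {subset value_set pts X <= [seq eval v X | v <- f o x y]}.
  case/hasP=> o _ /hasP[p _ /hasP[q _ /allP sub_f]].
  exists o, (vsub m p o), (vsub m q o) => _ /[!inE] /mapP[v /sub_f + ->].
  by rewrite vmemE => vf; apply/mapP; exists v.
move: rec_pts; rewrite /recognize.
case: Z.eqb_spec => [m7|_].
  move=> /coverP[o [x [y]]] A_sub.
  apply: (@cover_plane _ (eval o X) (eval x X) (eval y X)) => //; first by rewrite m7 in m0.
  by move=> a /A_sub; rewrite /= !inE !combE /=.
case: Z.eqb_spec => [m17|_].
  move=> /coverP[o [x [_]]] A_sub _; apply: Or32.
  have F17 : 17%:R = 0 :> F by rewrite m17 in m0.
  split; first by rewrite inE F17 eqxx.
  apply: (@cover_affine (map Z.of_nat [:: 0; 1; 2; 3; 5; 6; 14]%N) _ _ (eval o X) (eval x X)) => //.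
    by move=> a /A_sub; rewrite /= !inE !combE !mul0r !addr0.
  by move=> z; rewrite !inE -!orbA.
case: Z.eqb_spec => [m19|//].
move=> /coverP[o [x [_]]] A_sub _; apply: Or33.
have F19 : 19%:R = 0 :> F by rewrite m19 in m0.
split; first by rewrite inE F19 eqxx.
apply: (@cover_affine (map Z.of_nat [:: 0; 1; 2; 3; 8; 10; 13]%N) _ _ (eval o X) (eval x X)) => //.
  by move=> a /A_sub; rewrite /= !inE !combE !mul0r !addr0.
by move=> z; rewrite !inE -!orbA.
Qed.

End Recognize.

(** * The five initial patterns *)

(** The patterns are settled in the reverse of this order. A branch may stop only at patterns
    settled independently: 4-term progressions stop nowhere, [ap3_pair] at [ap4], three pairs at
    either, the line at [ap3_pair], and the symmetric pairs at [thrice]. *)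
Lemma search_thrice : root_search thrice [::] Z0 root_sym6.
Proof. by vm_compute. Qed.

Lemma search_line : root_search ap3_pair [::] (Zpos 3) root_line.
Proof. by vm_compute. Qed.

Lemma search_pairs :
  root_search (fun m pts => ap4 m pts || ap3_pair m pts) [::] Z0 root_pairs.
Proof. by vm_compute. Qed.

Lemma search_ap3_pair : root_search ap4 sym_ap3_pair Z0 root_ap3_pair.
Proof. by vm_compute. Qed.

Lemma search_ap4 : root_search (fun _ _ => false) sym_4ap Z0 root_4ap.
Proof. by vm_compute. Qed.

Section Patterns.

Variable F : fieldType.
Hypothesis two_neq0 : (2 : F) != 0.
Implicit Types A : {fset F}.
Notation zr := (@zr F).

Definition contains A (s : seq F) := uniq s /\ {subset s <= A}.

Definition has_ap4 A := exists a d, contains A [:: a; a + d; a + d + d; a + d + d + d].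
Definition has_ap3_pair A :=
  exists a d u, contains A [:: a; a + d; a + d + d; u; u + d].
Definition has_thrice A := exists d a b c,
  [/\ d != 0, contains A [:: a; b; c] & {subset [:: a + d; b + d; c + d] <= A}].

Section Values.

Variables (m : Z) (pts : seq lform) (X : seq F).
Hypothesis m0 : zr m = 0.
Hypothesis gX : generic pts X.

Lemma ap4P : ap4 m pts -> has_ap4 (value_set pts X).
Proof.
case/hasP=> a aP /hasP[b bP]; case: ifP => // ab.
cbv zeta; set d := vsub m b a; set c := vadd m b d; case: ifP => //; rewrite vmemE => cP.
case: ifP => // ca; set e := vadd m c d; case: ifP => // ea; rewrite vmemE => eP.
have neqV := eval_inj gX.
have dE : eval d X = eval b X - eval a X by rewrite eval_vsub.
have cE : eval c X = eval b X + eval d X by rewrite eval_vadd.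
have eE : eval e X = eval c X + eval d X by rewrite eval_vadd.
have bE : eval b X = eval a X + eval d X by rewrite dE addrC subrK.
have d0 : eval d X != 0 by rewrite dE subr_eq0 eq_sym neqV.
have dd0 : eval d X + eval d X != 0 by rewrite -mulr2n -mulr_natr mulf_neq0.
exists (eval a X), (eval d X); rewrite -bE -cE -eE; split; last first.
  by apply/allP; rewrite /= !mem_values.
have neqD (x y : F) : y != 0 -> x != x + y.
  by move=> y0; rewrite -subr_eq0 opprD addrA subrr sub0r oppr_eq0.
rewrite /= !inE !negb_or !andbT; apply/and3P; split.
- by rewrite neqV //= eq_sym neqV //= eq_sym neqV.
- by rewrite cE neqD //= eE cE -addrA neqD.
- by rewrite eE neqD.
Qed.

Lemma ap3_pairP : ap3_pair m pts -> has_ap3_pair (value_set pts X).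
Proof.
case/hasP=> a aP /hasP[b bP]; case: ifP => // ab.
cbv zeta; set d := vsub m b a; set c := vadd m b d; case: ifP => //; rewrite vmemE => cP.
case: ifP => // ca /hasP[u uP]; case: ifP => // u_abc.
set v := vadd m u d; case: ifP => //; rewrite vmemE => vP v_abc.
have neqV := eval_inj gX.
have dE : eval d X = eval b X - eval a X by rewrite eval_vsub.
have cE : eval c X = eval b X + eval d X by rewrite eval_vadd.
have vE : eval v X = eval u X + eval d X by rewrite eval_vadd.
have bE : eval b X = eval a X + eval d X by rewrite dE addrC subrK.
have d0 : eval d X != 0 by rewrite dE subr_eq0 eq_sym neqV.
exists (eval a X), (eval d X), (eval u X); rewrite -bE -cE -vE; split; last first.
  by apply/allP; rewrite /= !mem_values.
have neqW p q : p \in pts -> q \in [:: a; b; c] -> vmem p [:: a; b; c] = false ->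
    eval q X != eval p X.
  move=> pP qabc p_abc; rewrite eq_sym neqV //.
    by move: qabc; rewrite !inE => /or3P[]/eqP->.
  by apply: contraFF p_abc; rewrite veqE vmemE => /eqP->.
have neqD (x : F) : x + eval d X == x = false.
  by rewrite -subr_eq0 addrAC subrr add0r (negPf d0).
rewrite /= !inE !negb_or neqV // [eval a X == eval c X]eq_sym neqV //=.
rewrite cE [eval b X == _]eq_sym neqD -cE vE [eval u X == _]eq_sym neqD -vE /=.
have neqU q : q \in [:: a; b; c] -> eval q X != eval u X by move=> qP; apply: neqW.
have neqVv q : q \in [:: a; b; c] -> eval q X != eval v X.
  by move=> qP; apply: neqW => //; apply/negbTE.
by rewrite !neqU ?neqVv // !inE eqxx ?orbT.
Qed.

Lemma thriceP : thrice m pts -> has_thrice (value_set pts X).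
Proof.
case/hasP=> a aP /hasP[b bP]; case: ifP => // ab.
cbv zeta; set d := vsub m b a; rewrite -size_filter; set s := filter _ _.
have sP p : p \in s -> p \in pts /\ eval p X + eval d X \in value_set pts X.
  rewrite mem_filter vmemE => /andP[pdP pP]; split=> //.
  by rewrite -(eval_vadd m0) mem_values.
have us : uniq [seq eval p X | p <- s].
  have [uX _] := andP gX; apply: subseq_uniq uX.
  exact/map_subseq/filter_subseq.
case: s sP us => [|p [|q [|r s]]] //= sP us _.
have [[pP pdP] [qP qdP] [rP rdP]] : [/\ p \in pts /\ eval p X + eval d X \in value_set pts X,
    q \in pts /\ eval q X + eval d X \in value_set pts X
  & r \in pts /\ eval r X + eval d X \in value_set pts X].
  by split; apply: sP; rewrite !inE eqxx ?orbT.
exists (eval d X), (eval p X), (eval q X), (eval r X); split.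
- by rewrite eval_vsub // subr_eq0 eq_sym (eval_inj gX).
- split; last by apply/allP; rewrite /= !mem_values.
  move: us => /and4P[+ + _ _]; rewrite /= !inE !negb_or.
  by case/and3P=> -> -> _ /andP[-> _].
- by apply/allP; rewrite /= pdP qdP rdP.
Qed.

End Values.
End Patterns.

(** * Classification of the sets containing a pattern *)

Section Roots.

Variable F : fieldType.
Hypothesis two_neq0 : (2 : F) != 0.
Implicit Types A : {fset F}.
Notation zr := (@zr F).

Lemma contains_extend A s : contains A s ->
  exists r, size r = (#|` A| - size s)%N /\ A =i s ++ r.
Proof.
case=> us sA; exists [seq x <- A | x \notin s].
have s_perm : perm_eq A (s ++ [seq x <- A | x \notin s]).
  apply: uniq_perm; first exact: fset_uniq.
    rewrite cat_uniq us filter_uniq ?fset_uniq // andbT.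
    by apply/hasPn=> x; rewrite mem_filter => /andP[].
  move=> x; rewrite mem_cat mem_filter; case: (boolP (x \in s)) => [/sA->|] //.
split; last exact: perm_mem s_perm.
by have := perm_size s_perm; rewrite size_cat => ->; rewrite addKn.
Qed.

Lemma card_value_set pts (X : seq F) : generic pts X -> #|` value_set pts X| = 7%N.
Proof. by case/andP=> uX /eqP sz; rewrite card_fseq undup_id // size_map. Qed.

(** Seven values filling a set of seven elements are distinct, which is the genericity that the
    search assumes. *)
Lemma root_classified closed syms m pts A t (X : seq F) :
    closed_sound F closed -> root_search closed syms m pts -> zr m = 0 ->
    #|` A| = 7%N -> size pts = 7%N -> A =i [seq x + t | x <- values pts X] ->
  classified A.
Proof.
move=> closedP searchP m0 cardA size_pts AE.
have {}AE : A = affine_image 1 t (value_set pts X).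
  apply/fsetP=> z; rewrite AE; apply/mapP/imfsetP => /= -[x].
    by move=> xX ->; exists x; rewrite ?inE ?mul1r.
  by rewrite inE => xX ->; exists x; rewrite ?mul1r.
apply: (@classified_affine _ 1 (- t)); rewrite ?oner_neq0 // AE.
rewrite affine_image_comp mulr1 mul1r addrN affine_image_id.
apply: root_sound searchP m0 _ => //; first exact: recognizeP.
rewrite /generic size_pts eqxx andbT.
move: cardA; rewrite AE card_affine_image ?oner_neq0 // card_fseq => /eqP.
rewrite -[X in _ == X]size_pts -(size_map (fun p => eval p X) pts) => /eqP sz.
by apply/negPn/negP => /negPf nu; have := ltn_size_undup (values pts X); rewrite nu sz ltnn.
Qed.

Lemma zrS (n : nat) : zr (Z.of_nat n) = n%:R.
Proof. by elim: n => // n IHn; rewrite Nat2Z.inj_succ -Z.add_1_r zrD IHn -addn1 natrD. Qed.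

Definition zrE := (@zrN F, @zr0 F, @zr1 F, zrS 2, zrS 3).

Lemma ap4_classified A : #|` A| = 7%N -> has_ap4 A -> classified A.
Proof.
move=> cardA [a [d /contains_extend[r []]]]; rewrite cardA.
case: r => [|y [|z [|w [|]]]] //= _ AE.
apply: (@root_classified _ _ _ _ A a [:: d; y - a; z - a; w - a] _ search_ap4) => //.
move=> x; rewrite AE; congr (x \in _); rewrite /values /=.
rewrite -[Zpos 2]/(Z.of_nat 2) -[Zpos 3]/(Z.of_nat 3) !zrE.
by congr [:: _; _; _; _; _; _; _]; ring.
Qed.

Lemma ap3_pair_classified A : #|` A| = 7%N -> has_ap3_pair A -> classified A.
Proof.
move=> cardA [a [d [u /contains_extend[r []]]]]; rewrite cardA.
case: r => [|z [|w [|]]] //= _ AE.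
apply: (@root_classified _ _ _ _ A a [:: d; u - a; z - a; w - a] _ search_ap3_pair) => //.
  move=> m pts X m0 gX /(ap4P two_neq0 m0 gX); apply: ap4_classified.
  exact: card_value_set.
move=> x; rewrite AE; congr (x \in _); rewrite /values /=.
rewrite -[Zpos 2]/(Z.of_nat 2) !zrE.
by congr [:: _; _; _; _; _; _; _]; ring.
Qed.

Lemma pairs_classified A a b c d : #|` A| = 7%N ->
  contains A [:: a; a + d; b; b + d; c; c + d] -> classified A.
Proof.
move=> cardA /contains_extend[r []]; rewrite cardA.
case: r => [|w [|]] //= _ AE.
apply: (@root_classified _ _ _ _ A a [:: d; b - a; c - a; w - a] _ search_pairs) => //.
  move=> m pts X m0 gX /orP[/(ap4P two_neq0 m0 gX)|/(ap3_pairP m0 gX)].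
    by apply: ap4_classified; apply: card_value_set.
  by apply: ap3_pair_classified; apply: card_value_set.
move=> x; rewrite AE; congr (x \in _); rewrite /values /= !zrE.
by congr [:: _; _; _; _; _; _; _]; ring.
Qed.

Lemma line_classified A a d : #|` A| = 7%N -> 3%:R = 0 :> F ->
  contains A [:: a; a + d; a + d + d] -> classified A.
Proof.
move=> cardA F3 /contains_extend[r []]; rewrite cardA.
case: r => [|y [|z [|w [|v [|]]]]] //= _ AE.
apply: (@root_classified _ _ _ _ A a [:: d; y - a; z - a; w - a; v - a] _ search_line) => //.
  move=> m pts X m0 gX /(ap3_pairP m0 gX).
  by apply: ap3_pair_classified; apply: card_value_set.
move=> x; rewrite AE; congr (x \in _); rewrite /values /=.
rewrite -[Zpos 2]/(Z.of_nat 2) !zrE.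
by congr [:: _; _; _; _; _; _; _]; ring.
Qed.

(** Either the three pairs with difference [d] are disjoint, or two of them share a point and form a
    3-term progression, to which [step] adds the third pair. *)
Lemma thrice_classified A : #|` A| = 7%N -> has_thrice A -> classified A.
Proof.
move=> cardA [d [a [b [c [d0 [abc_uniq abcA] abcdA]]]]].
have neqD (x : F) : x != x + d.
  by rewrite -subr_eq0 opprD addrA subrr sub0r oppr_eq0.
have neqDD (x : F) : x != x + d + d.
  rewrite -addrA -subr_eq0 opprD addrA subrr sub0r oppr_eq0.
  by rewrite -mulr2n -mulr_natr mulf_neq0.
have [aA bA cA] : [/\ a \in A, b \in A & c \in A].
  by split; apply: abcA; rewrite !inE eqxx ?orbT.
have [adA bdA cdA] : [/\ a + d \in A, b + d \in A & c + d \in A].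
  by split; apply: abcdA; rewrite !inE eqxx ?orbT.
(* If the pair [y, y + d] meets the progression at an end, the result is a 4-term progression, or in
   characteristic 3 a line; otherwise it is a disjoint pair. *)
have step x y : x \in A -> y \in A -> x + d \in A -> y + d \in A -> x + d + d \in A ->
    y != x -> y != x + d -> classified A.
  move=> xA yA xdA ydA xddA yx yxd.
  have [yd|ydx] := eqVneq (y + d) x.
    have [F3|F3] := eqVneq (3%:R : F) 0.
      apply: (@line_classified A x d) => //; split; last by apply/allP; rewrite /= xA xdA xddA.
      by rewrite /= !inE negb_or neqD neqDD neqD.
    apply: ap4_classified => //; exists y, d; rewrite yd; split.
      have y3 : y != x + d + d.
        rewrite -yd -subr_eq0 !opprD !addrA subrr sub0r -!opprD oppr_eq0.
        by rewrite (_ : d + d + d = d * 3%:R) ?mulf_neq0 //; ring.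
      by rewrite /= !inE !negb_or !neqD !neqDD yx y3 -yd neqDD.
    by apply/allP; rewrite /= yA xA xdA xddA.
  have [ydd|yxdd] := eqVneq y (x + d + d).
    have [F3|F3] := eqVneq (3%:R : F) 0.
      apply: (@line_classified A x d) => //; split; last by apply/allP; rewrite /= xA xdA xddA.
      by rewrite /= !inE negb_or neqD neqDD neqD.
    apply: ap4_classified => //; exists x, d; rewrite -ydd; split.
      by rewrite /= !inE !negb_or [x == y]eq_sym [x + d == y]eq_sym yx yxd neqD eq_sym ydx ydd neqDD neqD.
    by apply/allP; rewrite /= xA xdA yA ydA.
  apply: ap3_pair_classified => //; exists x, d, y; split.
    rewrite /= !inE !negb_or neqD neqDD neqD [x == y]eq_sym yx [x == _]eq_sym ydx.
    rewrite [x + d == y]eq_sym yxd (inj_eq (addIr d)) [x == y]eq_sym yx.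
    by rewrite [x + d + d == y]eq_sym yxdd (inj_eq (addIr d)) [x + d == y]eq_sym yxd neqD.
  by apply/allP; rewrite /= xA xdA xddA yA ydA.
move: abc_uniq; rewrite /= !inE negb_or andbT => /andP[/andP[ab ac] bc].
have [ba ca cb] : [/\ b != a, c != a & c != b] by split; rewrite eq_sym.
have [abd|abd] := eqVneq (a + d) b; first by apply: (step a c); rewrite ?abd.
have [acd|acd] := eqVneq (a + d) c; first by apply: (step a b); rewrite ?acd.
have [bad|bad] := eqVneq (b + d) a; first by apply: (step b c); rewrite ?bad.
have [bcd|bcd] := eqVneq (b + d) c; first by apply: (step b a); rewrite ?bcd.
have [cad|cad] := eqVneq (c + d) a; first by apply: (step c b); rewrite ?cad.
have [cbd|cbd] := eqVneq (c + d) b; first by apply: (step c a); rewrite ?cbd.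
apply: (@pairs_classified A a b c d) => //; split.
  rewrite /= !inE !negb_or !neqD !(inj_eq (addIr d)) ab ac bc abd acd bcd.
  by rewrite eq_sym bad eq_sym cad eq_sym cbd.
by apply/allP; rewrite /= aA bA cA adA bdA cdA.
Qed.

Lemma sym6_classified A s x y z : #|` A| = 7%N ->
  contains A [:: x; s - x; y; s - y; z; s - z] -> classified A.
Proof.
move=> cardA /contains_extend[r []]; rewrite cardA.
case: r => [|w [|]] //= _ AE.
pose h := s / 2%:R.
have sh : s = h + h by rewrite -mulr2n -mulr_natr divfK.
apply: (@root_classified _ _ _ _ A h [:: x - h; y - h; z - h; w - h] _ search_thrice) => //.
  move=> m pts X m0 gX /(thriceP m0 gX).
  by apply: thrice_classified; apply: card_value_set.
move=> t; rewrite AE; congr (t \in _); rewrite /values /= sh.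
rewrite -[Zneg 1]/(Z.opp (Zpos 1)) !zrE.
by congr [:: _; _; _; _; _; _; _]; ring.
Qed.

End Roots.

(** * Additive energy *)

Section Energy.

Variable F : fieldType.
Hypothesis two_neq0 : (2 : F) != 0.
Variable A : {fset F}.
Hypothesis cardA : #|` A| = 7%N.

Local Open Scope nat_scope.

Definition reps (f : F -> F -> F) (z : F) : nat := \sum_(a <- A) \sum_(b <- A) (f a b == z).

Lemma sum_indicator (T : eqType) (Z : seq T) (z : T) (g : T -> nat) :
  uniq Z -> z \in Z -> \sum_(x <- Z) (z == x) * g x = g z.
Proof.
move=> uZ zZ; rewrite (bigD1_seq z) //= eqxx mul1n big1 ?addn0 // => x.
by rewrite eq_sym => /negPf->.
Qed.

Lemma sum_reps f (Z : {fset F}) (g : F -> nat) :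
    (forall a b, a \in A -> b \in A -> f a b \in Z) ->
  \sum_(z <- Z) reps f z * g z = \sum_(a <- A) \sum_(b <- A) g (f a b).
Proof.
move=> fZ; under eq_bigr => z _ do rewrite big_distrl /=.
rewrite exchange_big /=; apply: eq_big_seq => a aA.
under eq_bigr => z _ do rewrite big_distrl /=.
rewrite exchange_big /=; apply: eq_big_seq => b bA.
by rewrite sum_indicator ?fset_uniq // fZ.
Qed.

Lemma sumA1 : \sum_(a <- A) 1 = 7.
Proof. by rewrite sum1_size. Qed.

Lemma card_sum (Z : {fset F}) (k : nat) : \sum_(z <- Z) k = #|` Z| * k.
Proof. by rewrite big_const_seq count_predT iter_addn_0 mulnC. Qed.

Lemma sum_reps1 f (Z : {fset F}) :
    (forall a b, a \in A -> b \in A -> f a b \in Z) ->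
  \sum_(z <- Z) reps f z = 49.
Proof.
move=> fZ; have := sum_reps (fun=> 1) fZ.
under eq_bigr => z _ do rewrite muln1.
by move=> ->; rewrite !card_sum cardA.
Qed.

Lemma in_sumset a b : a \in A -> b \in A -> (a + b)%R \in sumset A.
Proof. exact: in_imfset2. Qed.

Lemma in_diffset a b : a \in A -> b \in A -> (a - b)%R \in diffset A.
Proof. exact: in_imfset2. Qed.

(** Both sides are the additive energy: [a - b = c - e] is the same equation as [a + e = c + b]. *)
Lemma energy :
  \sum_(d <- diffset A) reps (fun a b => a - b)%R d * reps (fun a b => a - b)%R d =
  \sum_(s <- sumset A) reps +%R s * reps +%R s.
Proof.
rewrite (sum_reps _ in_diffset) (sum_reps _ in_sumset) /reps.
apply: eq_bigr => a _; under eq_bigr => b _ do rewrite exchange_big /=.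
rewrite exchange_big /=; under [RHS]eq_bigr => b _ do rewrite exchange_big /=.
apply: eq_bigr => e _; rewrite exchange_big /=.
apply: eq_bigr => c _; apply: eq_bigr => b _.
by rewrite -subr_eq0 -[in RHS]subr_eq0; congr (nat_of_bool (_ == _)); ring.
Qed.

Lemma reps_sub d : reps (fun a b => a - b)%R d = count (fun b => b + d \in A)%R A.
Proof.
rewrite /reps exchange_big /= -sum1_count [RHS]big_mkcond /=.
apply: eq_bigr => b _; under eq_bigr => a _ do rewrite subr_eq addrC eq_sym -[nat_of_bool _]muln1.
case: (boolP (_ \in A)) => [bdA|bdA]; first by rewrite (@sum_indicator _ _ _ (fun=> 1)) ?fset_uniq.
rewrite big_seq big1 // => a aA; case: eqP => // adb.
by rewrite adb aA in bdA.
Qed.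

Lemma reps_sub_thrice d : d != 0%R -> 2 < reps (fun a b => a - b)%R d -> has_thrice A.
Proof.
move=> d0; rewrite reps_sub -size_filter; set s := filter _ _ => size_s.
have sP x : x \in s -> x \in A /\ (x + d)%R \in A by rewrite mem_filter => /andP[].
have : uniq s by rewrite filter_uniq ?fset_uniq.
case: s size_s sP => [|a [|b [|c s]]] //= _ sP us.
have [[aA adA] [bA bdA] [cA cdA]] : [/\ a \in A /\ (a + d)%R \in A,
    b \in A /\ (b + d)%R \in A & c \in A /\ (c + d)%R \in A].
  by split; apply: sP; rewrite !inE eqxx ?orbT.
exists d, a, b, c; split=> //; last by apply/allP; rewrite /= adA bdA cdA.
split; last by apply/allP; rewrite /= aA bA cA.
move: us => /and4P[+ + _ _]; rewrite /= !inE !negb_or.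
by case/and3P=> -> -> _ /andP[-> _].
Qed.

Lemma involution_pairs (T : eqType) (t : T -> T) (s : seq T) :
    involutive t -> uniq s -> {in s, forall x, t x \in s /\ t x != x} ->
  exists l, perm_eq s (flatten [seq [:: x; t x] | x <- l]).
Proof.
move=> tK; have [n] := ubnP (size s); elim: n s => // n IHn [|x s] size_s us sP.
  by exists [::].
have [txs tx] := sP x (mem_head x s).
have {}txs : t x \in s by move: txs; rewrite inE (negPf tx).
have x_rem : perm_eq (x :: s) [:: x, t x & rem (t x) s] by rewrite perm_cons perm_to_rem.
have u_rem : uniq [:: x, t x & rem (t x) s] by rewrite -(perm_uniq x_rem).
have [|||l lP] := IHn (rem (t x) s).
- by rewrite size_rem //; move: size_s => /=; case: (size s) => //= k; rewrite !ltnS => /ltnW.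
- by case/and3P: u_rem.
- move=> y y_rem; have ys : y \in x :: s by rewrite (perm_mem x_rem) !in_cons y_rem !orbT.
  have [tys ty] := sP y ys; split=> //.
  move: tys; rewrite (perm_mem x_rem) !in_cons => /or3P[/eqP tyx|/eqP/(can_inj tK) yx|//].
    have yE : y = t x by rewrite -tyx tK.
    by case/and3P: u_rem => _ /negP[]; rewrite -{1}yE.
  by rewrite yx in y_rem; case/and3P: u_rem => /negP[]; rewrite in_cons y_rem orbT.
by exists (x :: l); rewrite /= (perm_trans x_rem) // !perm_cons.
Qed.

Definition has_sym6 := exists s x y z,
  contains A [:: x; s - x; y; s - y; z; s - z]%R.

(** Counted apart because these [a] are the fixed points of [a |-> s - a]. *)
Definition doubles (s : F) : nat := \sum_(a <- A) (a + a == s)%R.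

Lemma sum_doubles : \sum_(s <- sumset A) doubles s = 7.
Proof.
rewrite exchange_big /= -[RHS]sumA1; apply: eq_big_seq => a aA.
under eq_bigr => s _ do rewrite -[nat_of_bool _]muln1.
by rewrite (@sum_indicator _ _ _ (fun=> 1)) ?fset_uniq ?in_sumset.
Qed.

Lemma doubles_le1 s : doubles s <= 1.
Proof.
rewrite /doubles; have [/hasP[a aA /eqP aas]|/hasPn no_a] := boolP (has (fun a => a + a == s)%R A).
  rewrite (bigD1_seq a) ?fset_uniq //= aas eqxx big1 // => b ba.
  case: eqP => // /eqP.
  rewrite -aas -!mulr2n -[(b *+ 2)%R]mulr_natr -[(a *+ 2)%R]mulr_natr (inj_eq (mulIf two_neq0)).
  by rewrite (negPf ba).
by rewrite big_seq big1 // => a /no_a/negPf->.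
Qed.

(* The involution [a |-> s - a] pairs off the [a] with [a + a != s]. *)
Lemma reps_add s : has_sym6 \/ exists2 k, k <= 2 & reps +%R s = doubles s + k.*2.
Proof.
have -> : reps +%R s = count (fun a => s - a \in A)%R A.
  rewrite /reps -sum1_count [RHS]big_mkcond /=; apply: eq_bigr => a _.
  under eq_bigr => b _ do rewrite addrC eq_sym -subr_eq -[nat_of_bool _]muln1.
  case: (boolP (_ \in A)) => [saA|saA]; first by rewrite (@sum_indicator _ _ _ (fun=> 1)) ?fset_uniq.
  rewrite big_seq big1 // => b bA; case: eqP => // sab.
  by rewrite sab bA in saA.
pose q := [seq a <- A | (s - a \in A)%R & (a + a != s)%R].
have tK : involutive (fun a => s - a)%R by move=> a; rewrite subKr.
have uq : uniq q by rewrite filter_uniq ?fset_uniq.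
have qP : {in q, forall a, (s - a \in q)%R /\ (s - a != a)%R}.
  move=> a; rewrite !mem_filter => /andP[/andP[saA aas] aA].
  rewrite subKr aA saA /= andbT; split; last by rewrite subr_eq eq_sym.
  apply: contra aas => /eqP; rewrite addrACA -opprD => /eqP; rewrite subr_eq eq_sym.
  by rewrite (inj_eq (addrI s)) eq_sym.
have [l lP] := involution_pairs tK uq qP.
have [size_l|size_l] := leqP (size l) 2; [right|left]; last first.
  have qA : {subset q <= A} by move=> x; rewrite mem_filter => /andP[].
  case: l size_l lP => [|x [|y [|z l]]] //= _ lP.
  exists s, x, y, z; split.
    have : uniq ([:: x; s - x; y; s - y; z; s - z]%R ++ flatten [seq [:: x; s - x]%R | x <- l]).
      by rewrite -(perm_uniq lP).
    by rewrite cat_uniq => /andP[].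
  move=> t tP; apply: qA; rewrite (perm_mem lP).
  by rewrite -[_ :: _]/([:: x; s - x; y; s - y; z; s - z]%R ++ _) mem_cat tP.
exists (size l) => //; have -> : (size l).*2 = size q.
  rewrite (perm_size lP) size_flatten /shape -map_comp sumnE big_map.
  by rewrite /= big_const_seq count_predT iter_addn_0 mul2n.
have countE P : count P A = \sum_(a <- A) P a.
  by rewrite -sum1_count big_mkcond; apply: eq_bigr => a _; case: (P a).
rewrite size_filter /doubles !countE -big_split /=.
rewrite [LHS]big_seq [RHS]big_seq; apply: eq_bigr => a aA.
have [aas|aas] := eqVneq (a + a)%R s; last by rewrite andbT.
by rewrite andbF -aas addrK aA.
Qed.

Lemma reps_gt0 f (Z : {fset F}) z : Z = [fset f a b | a in A, b in A] -> z \in Z -> 0 < reps f z.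
Proof.
move=> -> /imfset2P[a /= aA [b /= bA ->]].
by rewrite /reps (big_fsetD1 a) //= (big_fsetD1 b bA) /= eqxx.
Qed.

Lemma reps_sub0 : reps (fun a b => a - b)%R 0%R = 7.
Proof.
rewrite reps_sub -cardA; apply/eqP; rewrite -all_count; apply/allP => b bA.
by rewrite addr0.
Qed.

Lemma MSTD_structure : MSTD A -> has_thrice A \/ has_sym6.
Proof.
rewrite /MSTD => mstd; pose r := reps (fun a b => a - b)%R; pose R := reps +%R.
case: (boolP (has (fun d => (d != 0)%R && (2 < r d)) (diffset A))) => [/hasP[d _ /andP[d0 rd]]|/hasPn r_le2].
  by left; apply: reps_sub_thrice rd.
(* By [reps_add] the inequality holds at [s] unless three disjoint pairs have sum [s], so a failure
   gives [has_sym6]. If it holds everywhere, the energy yields a contradiction. *)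
case: (boolP (all (fun s => R s * R s + 8 <= 6 * R s + 3 * doubles s) (sumset A))) => [/allP R_le|/allPn[s sA R_gt]].
  exfalso.
  have D0 : 0%R \in diffset A.
    have [A0|[a aA]] := fset_0Vmem A; first by move: cardA; rewrite A0 cardfs0.
    by rewrite -(subrr a) in_diffset.
  have r_pos d : d \in diffset A -> 0 < r d by apply: reps_gt0.
  have r12 d : d \in diffset A `\ 0%R -> r d = 1 \/ r d = 2.
    rewrite in_fsetD1 => /andP[d0 dD]; have := r_pos d dD; have := r_le2 d dD.
    by rewrite d0 -leqNgt; case: (r d) => [|[|[|k]]] // _ _; [left|right].
  have r0 : r 0%R = 7 := reps_sub0.
  have sum_r := sum_reps1 in_diffset; have sum_R := sum_reps1 in_sumset.
  have en := energy; rewrite -/r -/R in sum_r sum_R en.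
  have cardD : #|` diffset A| = #|` diffset A `\ 0%R|.+1 by rewrite (cardfsD1 0%R) D0.
  rewrite (big_fsetD1 _ D0) /= r0 in sum_r.
  rewrite [X in X = _](big_fsetD1 _ D0) /= r0 in en.
  (* Since [r d] is 1 or 2, its square plus 2 equals three times it. *)
  have sq_r : \sum_(d <- diffset A `\ 0%R) r d * r d + #|` diffset A `\ 0%R| * 2 =
              3 * \sum_(d <- diffset A `\ 0%R) r d.
    rewrite -card_sum -big_split big_distrr /=; apply: eq_big_seq => d /r12[]-> //.
  have r_sum_le : \sum_(d <- diffset A `\ 0%R) r d <= #|` diffset A `\ 0%R| * 2.
    by rewrite -card_sum; rewrite [X in X <= _]big_seq [X in _ <= X]big_seq; apply: leq_sum => d /r12[]->.
  (* Every possible pair of values satisfies this; it is sharp at [R s = 2, 4, 5]. *)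
  have sq_R : \sum_(s <- sumset A) R s * R s + #|` sumset A| * 8 <=
              6 * \sum_(s <- sumset A) R s + 3 * \sum_(s <- sumset A) doubles s.
    rewrite -card_sum !big_distrr -!big_split /= [X in X <= _]big_seq [X in _ <= X]big_seq.
    exact: leq_sum.
  rewrite sum_R sum_doubles -en in sq_R; rewrite cardD in mstd.
  (* With [k] nonzero differences, their 42 representations give [k >= 21]. The energy is
     [49 + 126 - 2k], so [sq_R] reads [8 |A + A| <= 140 + 2k]; as [|A + A| >= k + 2], this gives
     [k <= 20]. *)
  move: sum_r sq_r r_sum_le sq_R mstd; clear.
  move: (\sum_(d <- _) r d * r d) (\sum_(d <- _) r d).
  move: #|` _ `\ _| #|` sumset _| => k n q t. lia.
right; case: (reps_add s) => // -[k k_le2 RE]; case/negP: R_gt.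
have : 0 < R s by apply: reps_gt0 sA.
rewrite /R RE; have := doubles_le1 s.
by case: (doubles s) => [|[|]] //; case: k k_le2 {RE} => [|[|[|]]].
Qed.

End Energy.

(** * The converse *)

Section Converse.

Variables (F : fieldType) (p : nat) (a b : F).
Hypotheses (p_gt0 : (0 < p)%N) (p0 : p%:R = 0 :> F).

Definition coords (c : nat * nat) : F := c.1%:R * a + c.2%:R * b.
Definition mod_coords (c : nat * nat) := (c.1 %% p, c.2 %% p)%N.
Definition coord_sums (cs : seq (nat * nat)) :=
  undup [seq mod_coords (c.1 + e.1, c.2 + e.2)%N | c <- cs, e <- cs].
(** Coordinates are natural numbers, so [p.-1] stands for -1. *)
Definition coord_diffs (cs : seq (nat * nat)) :=
  undup [seq mod_coords (c.1 + p.-1 * e.1, c.2 + p.-1 * e.2)%N | c <- cs, e <- cs].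

Lemma coords_mod c : coords (mod_coords c) = coords c.
Proof. by rewrite /coords /mod_coords /= !natr_mod. Qed.

(** Coordinates count differences from above and, where [coords] is injective, sums from below; so
    injectivity is asked on the sums. *)
Lemma MSTD_coords cs (B : {fset F}) :
    B =i [seq coords c | c <- cs] -> {in coord_sums cs &, injective coords} ->
  (size (coord_diffs cs) < size (coord_sums cs))%N -> MSTD B.
Proof.
move=> BE inj_sums lt_size; have p1 : (p.-1)%:R = - 1 :> F.
  by apply/eqP; rewrite -subr_eq0 opprK natr1 prednK // p0.
apply: (@leq_ltn_trans (size (map coords (coord_diffs cs)))).
  apply: uniq_leq_size; first exact: fset_uniq.
  move=> _ /imfset2P[x /= xB [y /= yB ->]].
  move: xB yB; rewrite !BE => /mapP[c cP ->] /mapP[e eP ->].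
  apply/mapP; exists (mod_coords (c.1 + p.-1 * e.1, c.2 + p.-1 * e.2)%N).
    by rewrite mem_undup; apply/allpairsP; exists (c, e).
  by rewrite coords_mod /coords /= !natrD !natrM p1; ring.
rewrite size_map (leq_trans lt_size) // -(size_map coords).
apply: uniq_leq_size; first by rewrite map_inj_in_uniq ?undup_uniq.
move=> _ /mapP[f fP ->]; move: fP; rewrite mem_undup => /allpairsP[[c e] /= [cP eP ->]].
rewrite coords_mod; apply/imfset2P; exists (coords c) => /=.
  by rewrite BE; apply/mapP; exists c.
exists (coords e); first by rewrite /= BE; apply/mapP; exists e.
by rewrite /coords /= !natrD; ring.
Qed.

End Converse.

(** * The three families are MSTD sets *)

Section Main.

Variable F : fieldType.

Lemma natr_inj_pchar p i j : p \in [pchar F] -> (i < p)%N -> (j < p)%N ->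
  i%:R = j%:R :> F -> i = j.
Proof.
wlog ij : i j / (i <= j)%N => [hwlog pF ip jp ijF|pF ip jp /esym/eqP].
  by case/orP: (leq_total i j) => /hwlog; [apply|move/(_ pF jp ip (esym ijF))].
rewrite -subr_eq0 -natrB // -(dvdn_pcharf pF) => p_dvd.
have [ji|ji] := posnP (j - i); first by apply/eqP; rewrite eqn_leq ij -subn_eq0 ji.
by have := dvdn_leq ji p_dvd; rewrite leqNgt (leq_ltn_trans (leq_subr _ _) jp).
Qed.

Lemma MSTD_residues p (ns : seq nat) (B : {fset F}) : p \in [pchar F] ->
    B =i [seq n%:R | n <- ns] ->
    let cs := [seq (n, 0%N) | n <- ns] in
    (size (coord_diffs p cs) < size (coord_sums p cs))%N ->
  MSTD B.
Proof.
move=> pF BE cs lt_size; have p_gt0 := prime_gt0 (pcharf_prime pF).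
apply: (MSTD_coords (a := 1) (b := 0) p_gt0 (pcharf0 pF)) lt_size.
  by move=> z; rewrite BE -map_comp; congr (z \in _); apply: eq_map => n; rewrite /coords /= mulr0 addr0 mulr1.
have sumsP c : c \in coord_sums p cs -> (c.1 < p)%N && (c.2 == 0)%N.
  rewrite mem_undup => /allpairsP[[_ _] /= [/mapP[i _ ->] /mapP[j _ ->] ->]] /=.
  by rewrite ltn_mod p_gt0 mod0n.
move=> [c1 c2] [e1 e2] /sumsP/= /andP[c1p /eqP->] /sumsP/= /andP[e1p /eqP->].
rewrite /coords /= !mulr0 !addr0 !mulr1 => /(natr_inj_pchar pF c1p e1p) -> //.
Qed.

(** Independence makes coordinate pairs with entries below 7 represent distinct elements; the two
    counts are then computed. *)
Lemma MSTD_plane (char7 : 7%N \in [pchar F]) (a b : F) : prime_lin_indep2 char7 a b ->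
  MSTD [fset 0; a; a + 2 * b; a + 3 * b; b; 2 * b; 4 * b].
Proof.
move=> indep; apply: (@MSTD_coords F 7 a b isT (pcharf0 char7) coefficients7); last by vm_compute.
  by move=> z; rewrite !inE /coords /= !mul0r !mul1r !add0r !addr0 -!orbA.
have sumsP c : c \in coord_sums 7 coefficients7 -> (c.1 < 7)%N && (c.2 < 7)%N.
  by rewrite mem_undup => /allpairsP[[? ?] /= [_ _ ->]]; rewrite !ltn_mod.
move=> [c1 c2] [e1 e2] /sumsP/= /andP[c1p c2p] /sumsP/= /andP[e1p e2p].
rewrite /coords /= => ce.
have scaleE (i : nat) (x : F) : (i%:R : 'F_7) *: (x : pPrimeCharType char7) = i%:R * x.
  by rewrite scaler_nat mulr_natl.
have FpE (i j : nat) : (i < 7)%N -> (j < 7)%N -> (i%:R - j%:R : 'F_7) = 0 -> i = j.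
  move=> i7 j7 /eqP; rewrite subr_eq0 => /eqP/(congr1 val).
  by rewrite /= !val_Fp_nat // !modn_small.
have [] := indep (c1%:R - e1%:R) (c2%:R - e2%:R).
  rewrite !scalerBl !scaleE; apply/eqP.
  rewrite addrACA -opprD subr_eq0; exact/eqP.
by move=> /(FpE _ _ c1p e1p) -> /(FpE _ _ c2p e2p) ->.
Qed.

End Main.

Theorem theorem1p3 (F : fieldType) (A : {fset F}) (cardA : #|` A| = 7%N) :
  MSTD A <->
  [\/ exists (char7 : 7%N \in [pchar F]) (a b : F),
        prime_lin_indep2 char7 a b /\
        affinely_equivalent A
          [fset 0; a; a + 2 * b; a + 3 * b; b; 2 * b; 4 * b],
      17%N \in [pchar F] /\
        affinely_equivalent A [fset 0; 1; 2; 3; 5; 6; 14]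
    | 19%N \in [pchar F] /\
        affinely_equivalent A [fset 0; 1; 2; 3; 8; 10; 13]].
Proof.
split=> [mstd|].
  have [two0|two_neq0] := eqVneq (2 : F) 0.
    have oppE (x : F) : - x = x.
      by apply/eqP; rewrite -subr_eq0 -opprD oppr_eq0 -mulr2n -mulr_natr two0 mulr0.
    have sum_diff : sumset A = diffset A.
      by apply/fsetP=> z; apply/imfset2P/imfset2P => -[x xA [y yA ->]];
        exists x => //; exists y; rewrite // oppE.
    by move: mstd; rewrite /MSTD sum_diff ltnn.
  have [A3|[s [x [y [z A6]]]]] := MSTD_structure two_neq0 cardA mstd.
    exact: thrice_classified two_neq0 A cardA A3 mstd.
  exact: sym6_classified two_neq0 A s x y z cardA A6 mstd.
case=> [[char7 [a [b [ab [x [y [x0 ->]]]]]]]|[p17 [x [y [x0 ->]]]]|[p19 [x [y [x0 ->]]]]];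
  apply/MSTD_affine => //.
- exact: MSTD_plane ab.
- apply: (@MSTD_residues F 17 [:: 0; 1; 2; 3; 5; 6; 14]%N _ p17); last by vm_compute.
  by move=> z; rewrite !inE -!orbA.
- apply: (@MSTD_residues F 19 [:: 0; 1; 2; 3; 8; 10; 13]%N _ p19); last by vm_compute.
  by move=> z; rewrite !inE -!orbA.
Qed.
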